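(* Let $C$ be a smooth projective complex curve, $M$ a line bundle on $C$ with $\deg M>0$, and $n\ge2$. Let $\Gamma\subset\mathrm{Pic}^0(C)[n]$ be a cyclic subgroup of order $d$, and let $a\in\mathcal{A}^0_n=\bigoplus_{j=2}^nH^0(C,M^j)$. Then $$\Gamma\subset K_a\iff a\in\mathcal{A}^0_\Gamma .$$
   Context: Spectral covers: let $|M|$ be the total space of $M$, $\pi:|M|\to C$ the projection, $t\in H^0(|M|,\pi^*M)$ the tautological coordinate. For $a=(a_1,\dots,a_n)\in\mathcal{A}_n=\mathcal{A}_n(C,M)=\bigoplus_{j=1}^nH^0(C,M^j)$ put $s_a=t^n+a_1t^{n-1}+\dots+a_{n-1}t+a_n\in H^0(|M|,\pi^*M^n)$, and let $X_a\subset|M|$ be the zero divisor of $s_a$, with its degree $n$ projection to $C$. $\mathcal{A}^0_n\subset\mathcal{A}_n$ is the subspace $a_1=0$. The group $K_a$: let $X_a=\bigcup_iX_i$ be the decomposition into irreducible components, $m_i$ the multiplicity of the reduced curve $X_i^{red}$ in $X_i$, $\widetilde X_i^{red}$ the normalization of $X_i^{red}$, with projection $\widetilde\pi_i$ to $C$. Put $K_i=\ker(\widetilde\pi_i^*:\mathrm{Pic}^0(C)\to\mathrm{Pic}^0(\widetilde X_i^{red}))$ and $K_a=\bigcap_i[m_i]^{-1}(K_i)\subset\mathrm{Pic}^0(C)$, where $[m_i]$ is multiplication by $m_i$ on $\mathrm{Pic}^0(C)$. The locus $\mathcal{A}^0_\Gamma$: let $\varphi:D=\mathrm{Spec}(\bigoplus_{L\in\Gamma}L)\to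 C$ be the étale Galois cover associated to $\Gamma$; its Galois group $\mathrm{Aut}(D/C)$ is cyclic of order $d$ and is identified with $\Gamma$. Let $N=\varphi^*M$ and $m=n/d$. $N$ has a canonical $\Gamma$-linearization, so $\Gamma$ acts on $|N|$ and on sections of powers of $\pi^*N$, where $\pi:|N|\to D$; the coordinate $t\in H^0(|N|,\pi^*N)$ is invariant. For $b=(b_1,\dots,b_m)\in\mathcal{A}_m(D,N)=\bigoplus_{j=1}^mH^0(D,N^j)$ put $s_b=t^m+b_1t^{m-1}+\dots+b_m$. The product $\prod_{\sigma\in\Gamma}s_b^\sigma\in H^0(|N|,\pi^*N^n)$ is $\Gamma$-invariant, hence descends to $|M|$, and equals $s_a$ for a unique $a\in\mathcal{A}_n$; put $\Phi_\Gamma(b)=a$. Let $H^0(D,N)_{var}$ be the direct sum of the character spaces $H^0(D,N)_\chi$ for non-trivial characters $\chi$ of $\Gamma$, and $\mathcal{A}_m^\Gamma(D,N)=H^0(D,N)_{var}\oplus\bigoplus_{j=2}^mH^0(D,N^j)$. Then $\mathcal{A}^0_\Gamma:=\Phi_\Gamma(\mathcal{A}_m^\Gamma(D,N))\subset\mathcal{A}_n^0$. *)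

(* Defs.v *)
From HB Require Import structures.
From mathcomp Require Export all_boot all_order all_algebra all_field.
From mathcomp Require Export generic_quotient ring_quotient qpoly qfpoly galois.
From mathcomp Require Export finmap boolp reals complex freeg.

Set Implicit Arguments.
Unset Strict Implicit.
Unset Printing Implicit Defensive.

Import Order.TTheory GRing.Theory Num.Theory.
Local Open Scope ring_scope.
Local Open Scope quotient_scope.

(* A smooth projective (connected) curve C over an algebraically closed field
   k is given by its function field K, with the structure map iota : k -> K,
   as the abstract nonsingular curve of all discrete valuation rings of K/k
   (Hartshorne, I.6): closed points are the normalized discrete valuations of
   K trivial on k, and the structure sheaf is the sheaf of subrings
   U |-> { f | f has no pole in U } of the constant sheaf K.  Finite morphisms
   of such curves are field extensions.  Every line bundle on C is isomorphic
   to O(D) = { f | div f + D >= 0 } for a divisor D, and Pic(C) is the group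
   of divisors modulo principal ones. *)

(* K is finite over k(x) for some x transcendental over k; the coefficients
   in k(x) of y are written over a common denominator q(x). *)
Definition function_field (k K : fieldType) (iota : {rmorphism k -> K}) :=
  exists x : K,
    (forall p : {poly k}, p != 0 -> (map_poly iota p).[x] != 0) /\
    exists e : seq K, forall y : K,
      exists (q : {poly k}) (p : nat -> {poly k}), q != 0 /\
        (map_poly iota q).[x] * y =
          \sum_(i < size e) (map_poly iota (p i)).[x] * e`_i.

(* The value ord 0 = 0 is a dummy: it makes two points with the same
   valuation on nonzero functions equal. *)
Record point (k K : fieldType) (iota : {rmorphism k -> K}) := Point {
  ord :> K -> int;
  ord_dummy : ord 0 = 0;
  ordM : forall f g, f != 0 -> g != 0 -> ord (f * g) = ord f + ord g;
  ordD : forall f g, f != 0 -> g != 0 -> f + g != 0 ->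
    Num.min (ord f) (ord g) <= ord (f + g);
  ord_const : forall c, c != 0 -> ord (iota c) = 0;
  ord_uniformizer : exists f, ord f == 1
}.

HB.instance Definition _ (k K : fieldType) (iota : {rmorphism k -> K}) :=
  gen_eqMixin (point iota).
HB.instance Definition _ (k K : fieldType) (iota : {rmorphism k -> K}) :=
  gen_choiceMixin (point iota).

Section Curve.
Variables (k K : fieldType) (iota : {rmorphism k -> K}).

Definition divisor := {freeg (point iota) / int}.

Definition mult_at (D : divisor) (P : point iota) : int := coeff P D.

(* f, as a section of O(D) near P, is regular at P. *)
Definition regular_at (D : point iota -> int) (P : point iota) (f : K) :=
  f != 0 -> - D P <= P f.

(* The global sections of O(D). *)
Definition H0 (D : point iota -> int) (f : K) := forall P, regular_at D P f.

(* O(D) is isomorphic to the structure sheaf. *)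
Definition is_div (D : point iota -> int) :=
  exists2 f : K, f != 0 & forall P, D P = P f.

Definition principal : {pred divisor} := fun D => `[< is_div (mult_at D) >].

Lemma ord1 (P : point iota) : P 1 = 0.
Proof. by rewrite -(rmorph1 iota) ord_const ?oner_eq0. Qed.

Lemma ordV (P : point iota) f : f != 0 -> P f^-1 = - P f.
Proof.
move=> f0; apply/eqP; rewrite -addr_eq0 -ordM ?invr_eq0 //.
by rewrite mulVf // ord1.
Qed.

Lemma principal_zmod_closed : zmod_closed principal.
Proof.
split=> [|D E /asboolP[f f0 Df] /asboolP[g g0 Eg]]; apply/asboolP.
  by exists 1 => [|P]; rewrite ?oner_eq0 // /mult_at coeff0 ord1.
exists (f / g) => [|P]; first by rewrite mulf_neq0 ?invr_eq0.
by rewrite /mult_at coeffB -!/(mult_at _ _) Df Eg ordM ?invr_eq0 // ordV.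
Qed.

HB.instance Definition _ :=
  GRing.isZmodClosed.Build divisor principal principal_zmod_closed.

Definition Pic : zmodType := Quotient.quot principal.

Definition class (D : divisor) : Pic := \pi_(Quotient.quot principal) D.

(* The degree on divisors is the unweighted sum of the coefficients, as the
   residue fields are all k when k is algebraically closed. *)
Definition Pic0 (L : Pic) := exists2 D : divisor, class D = L & deg D = 0.

End Curve.

Arguments class {k K iota} D.
Arguments H0 {k K iota} D f.
Arguments regular_at {k K iota} D P f.
Arguments is_div {k K iota} D.
Arguments Pic0 {k K iota} L.

(* The finite morphism phi^* : K -> L of function fields, from the curve of L
   to that of K. *)
Section Cover.
Variables (k K : fieldType) (iota : {rmorphism k -> K}).
Variables (L : fieldType) (phi : {rmorphism K -> L}).

Definition ext_const : {rmorphism k -> L} := phi \o iota.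

(* Q maps to P: the local ring of Q dominates that of P. *)
Definition lies_over (Q : point ext_const) (P : point iota) :=
  forall f, (0 <= P f -> 0 <= Q (phi f)) /\ (0 < P f -> 0 < Q (phi f)).

Definition uniformizer (P : point iota) : K := xchoose (ord_uniformizer P).

Definition ramification (Q : point ext_const) (P : point iota) : int :=
  if `[< lies_over Q P >] then Q (phi (uniformizer P)) else 0.

(* The pullback of a divisor, as the function giving its coefficients. *)
Definition pullback (D : divisor iota) (Q : point ext_const) : int :=
  \sum_(P <- dom D) mult_at D P * ramification Q P.

(* The kernel of Pic^0(C) -> Pic^0(C'), C' the curve of L. *)
Definition ker_pullback (c : Pic iota) :=
  Pic0 c /\ exists2 D : divisor iota, class D = c & is_div (pullback D).

End Cover.

Arguments pullback {k K iota L} phi D Q.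
Arguments ker_pullback {k K iota L} phi c.

(* A section of M^j over C, M = O(D), is an element of H0(j D) in K.  Over the
   generic point, the rational section 1 of M identifies |M| with the affine
   line Spec K[t] and the tautological coordinate with t.  The tuple
   (a_1,...,a_n) is indexed from 0: a_j is a (j - 1). *)
Definition hitchin_base (k K : fieldType) (iota : {rmorphism k -> K})
    (D : point iota -> int) (n : nat) (a : 'I_n -> K) :=
  forall j : 'I_n, H0 (fun P => D P *+ j.+1) (a j).

Definition hitchin_base0 (k K : fieldType) (iota : {rmorphism k -> K})
    (D : point iota -> int) (n : nat) (a : 'I_n -> K) :=
  hitchin_base D a /\ forall j : 'I_n, j = 0 :> nat -> a j = 0.

(* The equation s_a, on the generic fibre of |M|. *)
Definition spectral_poly (K : fieldType) (n : nat) (a : 'I_n -> K) : {poly K} :=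
  'X^n + \sum_(j < n) a j *: 'X^(n - j.+1).

Definition multiplicity (K : fieldType) (p s : {poly K}) : nat :=
  \max_(i < size s | p ^+ i %| s) i.

(* Since s_a is monic in t, its zero divisor X_a contains no fibre of |M|: each
   irreducible component X_i is the closure of a point of the generic fibre
   Spec K[t], that is, of a monic irreducible factor p of s_a.  Its
   multiplicity is the exponent of p in s_a, and the normalization of X_i^red
   is the curve with function field K[t]/(p). *)
Definition in_Ka (k K : fieldType) (iota : {rmorphism k -> K})
    (n : nat) (a : 'I_n -> K) (L : Pic iota) :=
  Pic0 L /\
  forall (p : {poly K}) (pI : monic_irreducible_poly p),
    p %| spectral_poly a ->
    ker_pullback (in_alg {poly %/ p with pI})
      (L *+ multiplicity p (spectral_poly a)).

Definition cyclic_subgroup (V : zmodType) (G : {fset V}) :=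
  exists g : V, forall x : V, x \in G <-> exists z : int, x = g *~ z.

(* The curve D of F, with its morphism to C, is Spec (\bigoplus_{L in Gamma} L):
   F is the direct sum of lines K u_L, and the sheaf of algebras phi_* O_D is
   the direct sum of its subsheaves O(E_L) u_L, where O(E_L) represents L, with
   O(E_L) u_L . O(E_L') u_L' = O(E_(L + L')) u_(L + L').  The stalk at P of
   phi_* O_D consists of the functions regular at all the points over P. *)
Definition cover_of (k K : fieldType) (iota : {rmorphism k -> K})
    (Gamma : {fset Pic iota}) (F : splittingFieldType K) :=
  exists (E : Gamma -> divisor iota) (u : Gamma -> F),
  [/\ forall L : Gamma, class (E L) = val L,
      forall z : F, exists! x : {ffun Gamma -> K},
        z = \sum_(L : Gamma) x L *: u L,
      forall (P : point iota) (x : {ffun Gamma -> K}),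
        (forall Q : point (ext_const iota (in_alg F)), lies_over Q P ->
           regular_at (fun=> 0) Q (\sum_(L : Gamma) x L *: u L)) <->
        (forall L : Gamma, regular_at (mult_at (E L)) P (x L))
    & forall L1 L2 L3 : Gamma, val L3 = val L1 + val L2 ->
        exists2 g : K, g != 0 &
          u L1 * u L2 = g *: u L3 /\
          forall P : point iota, P g = mult_at (E L1 + E L2 - E L3) P].

Section GammaLocus.
Variables (k K : fieldType) (iota : {rmorphism k -> K}) (F : splittingFieldType K).

(* Aut(D/C); it acts on sections of powers of N = phi^* M, which are elements
   of F, through its action on F. *)
Local Notation Gal := ('Gal({:F} / 1%AS))%g.

Definition nontrivial_character (chi : gal_of {:F} -> k) :=
  [/\ chi 1%g = 1,
      {in Gal &, forall s t, chi (s * t)%g = chi s * chi t}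
    & exists2 s, s \in Gal & chi s != 1].

Definition H0_chi (D : point (ext_const iota (in_alg F)) -> int)
    (chi : gal_of {:F} -> k) (f : F) :=
  H0 D f /\ forall s, s \in Gal -> s f = ext_const iota (in_alg F) (chi s) * f.

Definition H0_var (D : point (ext_const iota (in_alg F)) -> int) (f : F) :=
  exists (r : nat) (chi : 'I_r -> gal_of {:F} -> k) (g : 'I_r -> F),
    (forall i, nontrivial_character (chi i) /\ H0_chi D (chi i) (g i)) /\
    f = \sum_(i < r) g i.

Definition A_var (D : point (ext_const iota (in_alg F)) -> int)
    (m : nat) (b : 'I_m -> F) :=
  hitchin_base D b /\ forall j : 'I_m, j = 0 :> nat -> H0_var D (b j).

(* a = Phi_Gamma(b). *)
Definition is_Phi (n m : nat) (b : 'I_m -> F) (a : 'I_n -> K) :=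
  \prod_(s in Gal) map_poly s (spectral_poly b) =
  map_poly (in_alg F) (spectral_poly a).

Definition in_A0_Gamma (M : divisor iota) (d n : nat) (a : 'I_n -> K) :=
  exists b : 'I_(n %/ d) -> F,
    A_var (pullback (in_alg F) M) b /\ is_Phi b a.

End GammaLocus.

(* Main.v *)
(** The cover D -> C is a Kummer extension F = K(u) with u^d = h, where
    div h = d E and the class of E generates Gamma.  If p is an irreducible factor
    of s_a of multiplicity m and L = K[t]/(p), the m-th power of the class of E
    becomes trivial on the curve of L if and only if h^m is a d-th power in L: if
    div f = m E on L, then f^d / h^m has neither zeros nor poles and hence is
    constant.  On the other hand, h^m is a d-th power in L if and only if p^m is a
    norm from F[t].  For one direction, put e = gcd(d, m); Bezout gives T in K[t]
    with T^(d/e) = h modulo p, so that p is the product of the gcd(p, T - z^i u^e)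
    for a primitive (d/e)-th root of unity z, and the norm of gcd(p, T - u^e) is
    p^e.  For the other direction, an irreducible factor r of p over F whose
    stabilizer in Gal(F/K) has order e has norm p^e, so e divides m, and Galois
    descent yields T with T^(d/e) = h modulo p.  So Gamma is contained in K_a if and
    only if s_a is the norm of a monic polynomial s_b over F.  The coefficients of
    s_b are then regular by the Gauss lemma, and since a_1 = 0 is the trace of b_1,
    b_1 is a sum of eigenvectors for non-trivial characters. *)

From mathcomp Require Import classical_sets.
From mathcomp Require Import fingroup cyclic ring zify.
Require Import Defs.

Set Implicit Arguments.
Unset Strict Implicit.
Unset Printing Implicit Defensive.

Import Order.TTheory GRing.Theory Num.Theory.
Local Open Scope ring_scope.
Local Open Scope quotient_scope.

(** * Points of curves and finite morphisms *)

(** The points of a curve are all the discrete valuations of its function field, so passing from a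
    function without zeros and poles to a constant requires producing a valuation that is positive
    at a given non-constant function. Zorn's lemma gives only a valuation ring; that it is discrete
    comes from the finite degree of the function field over [k(x)]. In the same way a pullback of
    divisors can be evaluated only once every valuation upstairs is known to restrict to a positive
    multiple of exactly one valuation downstairs. Being the norm of a monic polynomial is
    multiplicative, which reduces the criterion to the exact prime powers [p^m] in [s_a]. The factor
    [p] alone need not be a norm: the least power of [p] that is one has an exponent e dividing d,
    and the criterion amounts to e dividing m. This is where the multiplicities in the definition of
    [K_a] enter. *)

Section Valuations.
Variables (k K : fieldType) (iota : {rmorphism k -> K}).
Implicit Types (P : point iota) (f g : K) (c : int).

Lemma point_eq P P' : (forall f, f != 0 -> P f = P' f) -> P = P'.
Proof.
case: P => v v0 vM vD vc vu; case: P' => v' v'0 vM' vD' vc' vu' /= vv'.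
have {vv'} E : v = v'.
  by apply/funext => f; have [->|/vv'//] := eqVneq f 0; rewrite v0 v'0.
by case: v' / E v'0 vM' vD' vc' vu' => *; congr Point; apply: Prop_irrelevance.
Qed.

Lemma ordX P f n : f != 0 -> P (f ^+ n) = P f *+ n.
Proof.
move=> f0; elim: n => [|n IHn]; first by rewrite expr0 ord1.
by rewrite exprS mulrS ordM ?expf_neq0 // IHn.
Qed.

Lemma ordXz P f (z : int) : f != 0 -> P (f ^ z) = P f *~ z.
Proof.
move=> f0; case: z => n; first exact: ordX.
by rewrite NegzE mulrNz -invr_expz ordV ?expf_neq0 // -exprnP ordX.
Qed.

Lemma ordN P f : P (- f) = P f.
Proof.
have [->|f0] := eqVneq f 0; first by rewrite oppr0.
have := @ord_const _ _ _ P (-1); rewrite rmorphN1 => N1.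
by rewrite -mulN1r ordM ?oppr_eq0 ?oner_eq0 // N1 ?add0r // oppr_eq0 oner_eq0.
Qed.

(** The lower bound c for the order, with 0 counted as having infinite order, which the dummy value
    [ord 0 = 0] does not provide. *)
Definition ord_ge P c f := f != 0 -> c <= P f.

Lemma ord_ge0 P c : ord_ge P c 0. Proof. by rewrite /ord_ge eqxx. Qed.

Lemma ord_geW P c c' f : c' <= c -> ord_ge P c f -> ord_ge P c' f.
Proof. by move=> le_c Pf f0; apply: le_trans (Pf f0). Qed.

Lemma ord_geD P c f g : ord_ge P c f -> ord_ge P c g -> ord_ge P c (f + g).
Proof.
move=> Pf Pg fg0; have [f0|f0] := eqVneq f 0.
  by move: fg0; rewrite f0 add0r; apply: Pg.
have [g0|g0] := eqVneq g 0; first by move: fg0; rewrite g0 addr0; apply: Pf.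
by apply: le_trans (ordD P f0 g0 fg0); rewrite le_min Pf ?Pg.
Qed.

Lemma ord_geN P c f : ord_ge P c f -> ord_ge P c (- f).
Proof. by move=> Pf; rewrite /ord_ge oppr_eq0 ordN. Qed.

Lemma ord_geM P c c' f g :
  ord_ge P c f -> ord_ge P c' g -> ord_ge P (c + c') (f * g).
Proof.
move=> Pf Pg; rewrite /ord_ge mulf_eq0 => /norP[f0 g0].
by rewrite ordM // lerD ?Pf ?Pg.
Qed.

Lemma ord_ge_sum P c (I : Type) (r : seq I) (A : pred I) (G : I -> K) :
  (forall i, A i -> ord_ge P c (G i)) -> ord_ge P c (\sum_(i <- r | A i) G i).
Proof.
by move=> PG; elim/big_ind: _ => //; [apply: ord_ge0 | apply: ord_geD].
Qed.

Lemma ord_ge_const P (c : k) : ord_ge P 0 (iota c).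
Proof. by rewrite /ord_ge fmorph_eq0 => c0; rewrite ord_const. Qed.

(** The ultrametric principle: a term whose order is strictly the smallest cannot be cancelled by
    the others. *)
Lemma ord_ge_lead P c f g :
  f != 0 -> P f = c -> ord_ge P (c + 1) g -> ~ ord_ge P (c + 1) (f + g).
Proof.
move=> f0 Pf Pg Pfg; have := ord_geD Pfg (ord_geN Pg).
by rewrite addrK => /(_ f0); rewrite Pf gerDl.
Qed.

End Valuations.

(** * Restriction of points along a morphism of curves *)

Section Restriction.
Variables (k K L : fieldType) (iota : {rmorphism k -> K}).
Variable (phi : {rmorphism K -> L}).
Implicit Types (P : point iota) (Q : point (ext_const iota phi)).

(** Domination sends units at P to units at Q, and every function is a unit times a power of a
    uniformizer u; the ramification index is the order of u at Q. *)
Lemma lies_over_index Q P : lies_over Q P ->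
  exists2 e : int, 0 < e & forall f, f != 0 -> Q (phi f) = e * P f.
Proof.
move=> QP; have Qunit f : f != 0 -> P f = 0 -> Q (phi f) = 0.
  move=> f0 Pf; have [+ _] := QP f; have [+ _] := QP f^-1.
  rewrite ordV // Pf oppr0 lexx => /(_ isT) + /(_ isT).
  rewrite fmorphV ordV ?fmorph_eq0 // oppr_ge0 => Q0 Q0'.
  by apply: le_anti; rewrite Q0.
have [u /eqP Pu] := ord_uniformizer P.
have u0 : u != 0 by apply: contra_eq_neq Pu => ->; rewrite ord_dummy.
exists (Q (phi u)) => [|f f0]; first by have [_] := QP u; rewrite Pu; apply.
have uz z : u ^ z != 0 by rewrite expfz_eq0 negb_and u0 orbT.
have := Qunit (f / u ^ P f); rewrite mulf_eq0 invr_eq0 negb_or f0 uz.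
rewrite ordM ?invr_eq0 ?uz // ordV ?uz // ordXz // Pu intz subrr.
move=> /(_ isT erefl); rewrite rmorphM /= fmorphV ordM ?invr_eq0 ?fmorph_eq0 ?uz //.
rewrite ordV ?fmorph_eq0 ?uz // rmorphXz ?unitfE // ordXz ?fmorph_eq0 //.
by move=> /eqP; rewrite subr_eq0 -mulrzl mulrC => /eqP->; rewrite intz.
Qed.

Lemma lies_over_inj Q P P' : lies_over Q P -> lies_over Q P' -> P = P'.
Proof.
move=> /lies_over_index[e e0 QP] /lies_over_index[e' e'0 QP'].
(* A normalized valuation takes the value 1, so each of two proportional ones bounds the factor of
   the other. *)
have PP' (R R' : point iota) (c c' : int) : 0 < c -> 0 < c' ->
    (forall f, f != 0 -> c * R f = c' * R' f) -> c' <= c.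
  move=> c0 c'0 RR'; have [u /eqP Ru] := ord_uniformizer R.
  have u0 : u != 0 by apply: contra_eq_neq Ru => ->; rewrite ord_dummy.
  have := RR' u u0; rewrite Ru mulr1 => c_eq; move: c0; rewrite c_eq.
  by rewrite pmulr_rgt0 // => Ru0; rewrite ler_peMr ?(ltW c'0) // -gtz0_ge1.
have Eee : forall f, f != 0 -> e * P f = e' * P' f.
  by move=> f f0; rewrite -QP ?QP'.
have ee' : e = e'.
  apply: le_anti; rewrite (PP' P P' e e') // andbT.
  by apply: (PP' P' P e' e) => // f f0; rewrite Eee.
apply: point_eq => f f0; apply: (mulfI (lt0r_neq0 e0)).
by rewrite Eee ?ee'.
Qed.

Definition algebraic_ext := forall y : L,
  exists2 p : {poly K}, p != 0 & root (map_poly phi p) y.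

Hypothesis phi_alg : algebraic_ext.

(** If Q were trivial on K, the non-zero terms of an algebraic equation for an element of order 1
    would have pairwise distinct orders and could not sum to zero. *)
Lemma ord_phi_neq0 Q : exists2 f, f != 0 & Q (phi f) != 0.
Proof.
apply: contrapT => Q0.
have {}Q0 f : f != 0 -> Q (phi f) = 0.
  by move=> f0; apply/eqP/negP=> /negP Qf; apply: Q0; exists f.
have [y /eqP Qy] := ord_uniformizer Q.
have y0 : y != 0 by apply: contra_eq_neq Qy => ->; rewrite ord_dummy.
have [p p0 /rootP] := phi_alg y; rewrite horner_coef size_map_poly => py0.
have exp : exists i, p`_i != 0.
  by exists (size p).-1; rewrite -lead_coefE lead_coef_eq0.
have i_min := ex_minnP exp; case: i_min => i pi0 i_min.
have lti : (i < size p)%N.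
  by rewrite ltnNge; apply: contra pi0 => /(nth_default 0)->.
move: py0; rewrite (bigD1 (Ordinal lti)) //= coef_map => py0.
apply: (@ord_ge_lead _ _ _ Q i _ _ _ _ _
  (eq_ind_r (ord_ge Q (i%:Z + 1)) (ord_ge0 Q _) py0)).
- by rewrite mulf_neq0 ?expf_neq0 // fmorph_eq0.
- by rewrite ordM ?expf_neq0 ?fmorph_eq0 // Q0 // ordX // Qy add0r natz.
apply: ord_ge_sum => j /eqP ne_ji; rewrite coef_map /= => pjy0.
have /norP[pj0 _] : ~~ ((p`_j == 0) || (y ^+ j == 0)).
  by move: pjy0; rewrite mulf_eq0 fmorph_eq0.
rewrite ordM ?expf_neq0 ?fmorph_eq0 // Q0 // ordX // Qy add0r natz lezD1 ltz_nat.
rewrite ltn_neqAle i_min // andbT; apply/negP => /eqP ij; apply: ne_ji.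
exact/val_inj.
Qed.

(** The orders at Q of functions from below form a non-zero subgroup of the integers. Dividing by
    its least positive element [n.+1] normalizes the restricted valuation. *)
Lemma lies_over_exists Q : exists P, lies_over Q P.
Proof.
pose A n := `[< exists2 f, f != 0 & Q (phi f) = n.+1%:Z >].
have exA : exists n, A n.
  have [f f0 Qf] := ord_phi_neq0 Q.
  have Qf' : (0 < `|Q (phi f)|)%N by rewrite absz_gt0.
  exists `|Q (phi f)|.-1; apply/asboolP; rewrite prednK //.
  case: (ger0P (Q (phi f))) => Qge; first by exists f => //; rewrite gez0_abs.
  exists f^-1; first by rewrite invr_eq0.
  by rewrite fmorphV ordV ?fmorph_eq0 // ltz0_abs.
case: (ex_minnP exA) => n /asboolP[u u0 Qu] n_min.
have dvdQ f : f != 0 -> (n.+1 %| Q (phi f))%Z.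
  move=> f0; apply/dvdz_mod0P; set q := (Q (phi f) %/ n.+1)%Z.
  have Qr : Q (phi (f / u ^ q)) = (Q (phi f) %% n.+1)%Z.
    rewrite rmorphM fmorphV rmorphXz ?unitfE // ordM ?ordV ?ordXz;
      rewrite ?invr_eq0 ?expfz_eq0 ?fmorph_eq0 ?(negPf u0) ?andbF //.
    by rewrite Qu {1}(divz_eq (Q (phi f)) n.+1) -/q -mulrzl intz addrAC subrr add0r.
  have r0 : (0 <= Q (phi f) %% n.+1)%Z by apply: modz_ge0.
  have rn : (Q (phi f) %% n.+1 < n.+1)%Z by apply: ltz_pmod.
  case Dr: (Q (phi f) %% n.+1)%Z Qr r0 rn => [[|r]|r] //= Qr _.
  rewrite ltz_nat ltnS => ltrn.
  suff /n_min : A r by rewrite leqNgt ltrn.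
  apply/asboolP.
  by exists (f / u ^ q) => //; rewrite mulf_neq0 ?invr_eq0 ?expfz_neq0.
pose v (f : K) := if f == 0 then 0 else (Q (phi f) %/ n.+1)%Z.
have vE f : f != 0 -> Q (phi f) = v f * n.+1%:Z.
  by move=> f0; rewrite /v (negPf f0) divzK ?dvdQ.
have n0 : n.+1%:Z != 0 by [].
have v0 : v 0 = 0 by rewrite /v eqxx.
have vM f g : f != 0 -> g != 0 -> v (f * g) = v f + v g.
  move=> f0 g0; apply: (mulIf n0); rewrite -vE ?mulf_neq0 // mulrDl -!vE //.
  by rewrite rmorphM ordM ?fmorph_eq0.
have vD f g : f != 0 -> g != 0 -> f + g != 0 -> Num.min (v f) (v g) <= v (f + g).
  move=> f0 g0 fg0; rewrite -(@ler_pM2r _ n.+1%:Z) // -vE // minr_pMl //.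
  by rewrite -!vE // rmorphD ordD ?fmorph_eq0 // -rmorphD fmorph_eq0.
have vc c : c != 0 -> v (iota c) = 0.
  move=> c0; apply: (mulIf n0); rewrite mul0r -vE ?fmorph_eq0 //.
  by rewrite -[phi _]/(ext_const iota phi c) ord_const.
have vu : exists f, v f == 1.
  by exists u; apply/eqP/(mulIf n0); rewrite -vE // Qu mul1r.
exists (Point v0 vM vD vc vu) => f /=.
have [->|f0] := eqVneq f 0; first by rewrite v0 rmorph0 ord_dummy.
by rewrite vE // pmulr_lge0 // pmulr_lgt0.
Qed.

(** Since Q lies over a single point P, the sum defining [pullback] has at most one non-zero
    term. *)
Lemma pullbackE Q : exists P (e : int), [/\ lies_over Q P, 0 < e,
  forall f, f != 0 -> Q (phi f) = e * P f
  & forall D : divisor iota, pullback phi D Q = e * mult_at D P].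
Proof.
have [P QP] := lies_over_exists Q; have [e e0 QeP] := lies_over_index QP.
exists P, e; split=> // D; rewrite /pullback.
have ram : ramification Q P = e.
  rewrite /ramification asboolT // /uniformizer.
  have /eqP := xchooseP (ord_uniformizer P); set u := xchoose _ => Pu.
  have u0 : u != 0 by apply: contra_eq_neq Pu => ->; rewrite ord_dummy.
  by rewrite QeP // Pu mulr1.
have ram0 P' : P' != P -> ramification Q P' = 0.
  rewrite /ramification; case: asboolP => // QP' /eqP[].
  exact: lies_over_inj QP' QP.
have [PD|PD] := boolP (P \in dom D).
  rewrite (bigD1_seq P) ?uniq_dom //= big1 ?addr0 ?ram 1?mulrC // => P' /ram0->.
  by rewrite mulr0.
rewrite /mult_at coeff_outdom // mulr0 big1_seq // => P' /andP[_ P'D].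
by rewrite ram0 ?mulr0 //; apply: contraNneq PD => <-.
Qed.

End Restriction.
(** * Existence of points *)

Section ValuationRings.
Local Open Scope classical_set_scope.
Local Open Scope ring_scope.
Variables (k L : fieldType) (iota : {rmorphism k -> L}).

Definition subalgebra (A : L -> Prop) :=
  [/\ forall c, A (iota c), forall x y, A x -> A y -> A (x - y)
    & forall x y, A x -> A y -> A (x * y)].

Definition valuation_subring (A : L -> Prop) :=
  subalgebra A /\ forall x, A x \/ A x^-1.

Section Subalgebra.
Variable A : L -> Prop.
Hypothesis subA : subalgebra A.

Lemma subalg0 : A 0. Proof. by case: subA => + _ _ => /(_ 0); rewrite rmorph0. Qed.

Lemma subalg1 : A 1. Proof. by case: subA => + _ _ => /(_ 1); rewrite rmorph1. Qed.

Lemma subalgB x y : A x -> A y -> A (x - y). Proof. by case: subA => _ + _; apply. Qed.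

Lemma subalgM x y : A x -> A y -> A (x * y). Proof. by case: subA => _ _; apply. Qed.

Lemma subalgN x : A x -> A (- x).
Proof. by rewrite -sub0r; apply/subalgB/subalg0. Qed.

Lemma subalgD x y : A x -> A y -> A (x + y).
Proof. by move=> Ax /subalgN; rewrite -{2}(opprK y); apply: subalgB. Qed.

Lemma subalgX x n : A x -> A (x ^+ n).
Proof.
by move=> Ax; elim: n => [|n IHn]; [apply: subalg1 | rewrite exprS; apply: subalgM].
Qed.

Lemma subalg_sum (I : Type) (r : seq I) (P : pred I) (G : I -> L) :
  (forall i, P i -> A (G i)) -> A (\sum_(i <- r | P i) G i).
Proof. by move=> AG; elim/big_ind: _ => //; [apply: subalg0 | apply: subalgD]. Qed.

Lemma subalg_horner (q : {poly L}) x : (forall i, A q`_i) -> A x -> A q.[x].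
Proof.
by move=> Aq Ax; rewrite horner_coef; apply: subalg_sum => i _; apply/subalgM/subalgX.
Qed.

Lemma subalg_map_horner (q : {poly k}) x : A x -> A (map_poly iota q).[x].
Proof. by apply: subalg_horner => i; rewrite coef_map /=; case: subA. Qed.

Definition adjoin_sub y : L -> Prop :=
  fun z => exists2 q : {poly L}, forall i, A q`_i & z = q.[y].

Lemma adjoin_subP y : [/\ subalgebra (adjoin_sub y),
  forall z, A z -> adjoin_sub y z & adjoin_sub y y].
Proof.
have subC z : A z -> adjoin_sub y z.
  move=> Az; exists z%:P; rewrite ?hornerC // => i; rewrite coefC.
  by case: ifP => // _; apply: subalg0.
split=> //; last first.
  exists 'X; rewrite ?hornerX // => i; rewrite coefX.
  by case: (i == 1)%N; [apply: subalg1 | apply: subalg0].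
split=> [c|_ _ [p Ap ->] [q Aq ->]|_ _ [p Ap ->] [q Aq ->]].
- by apply: subC; case: subA.
- by exists (p - q); rewrite ?hornerE // => i; rewrite coefB; apply: subalgB.
- exists (p * q); rewrite ?hornerE // => i; rewrite coefM.
  by apply: subalg_sum => j _; apply: subalgM.
Qed.

End Subalgebra.

(* A subring that is maximal among those containing [iota k] and [w] but not
   [w^-1] is a valuation ring. *)
Lemma exists_valuation_subring (w : L) : w != 0 ->
    (forall p : {poly k}, (map_poly iota p).[w] != w^-1) ->
  exists A, [/\ valuation_subring A, A w & ~ A w^-1].
Proof.
move=> w0 wk.
pose good (A : set L) := [/\ subalgebra A, A w & ~ A w^-1].
pose B := adjoin_sub (fun z => exists c, z = iota c) w.
have gB : good B.
  have [|sB _ Bw] := @adjoin_subP (fun z => exists c, z = iota c) _ w; last first.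
    split=> // -[q kq] /eqP; apply/negP; rewrite eq_sym.
    have [c Dc] : exists c, forall i, q`_i = iota (c i).
      exists (fun i => xget 0 [set a | q`_i = iota a]) => i.
      by case: xgetP => // no; have [a /no] := kq i.
    suff ->: q = map_poly iota (\poly_(i < size q) c i) by apply: wk.
    apply/polyP => i; rewrite coef_map coef_poly /=; case: ltnP => // leqi.
    by rewrite rmorph0 nth_default.
  split=> [c|_ _ [a ->] [b ->]|_ _ [a ->] [b ->]]; first by exists c.
    by exists (a - b); rewrite rmorphB.
  by exists (a * b); rewrite rmorphM.
have [|A [PA A_max]] := @Zorn_bigcup L (fun A => A !=set0 -> good A).
  move=> F FP totF [x0 [X0 FX0 X0x0]].
  have FgX X x : F X -> X x -> good X by move=> FX Xx; apply: FP => //; exists x.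
  have FF x y : (\bigcup_(X in F) X) x -> (\bigcup_(X in F) X) y ->
      exists X, [/\ F X, X x & X y].
    move=> [X FX Xx] [Y FY Yy]; case: (totF X Y FX FY) => [XY|YX].
      by exists Y; split=> //; apply: XY.
    by exists X; split=> //; apply: YX.
  have [[X0c _ _] X0w _] := FgX _ _ FX0 X0x0.
  split=> [||[X FX Xw]]; last by have [_ _] := FgX _ _ FX Xw.
    split=> [c|x y Ux Uy|x y Ux Uy]; first by exists X0.
      have [X [FX Xx Xy]] := FF x y Ux Uy; have [[_ XB _] _ _] := FgX _ _ FX Xx.
      by exists X => //; apply: XB.
    have [X [FX Xx Xy]] := FF x y Ux Uy; have [[_ _ XM] _ _] := FgX _ _ FX Xx.
    by exists X => //; apply: XM.
  by exists X0.
have {PA}[sA Aw Aw'] : good A.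
  apply: PA; have [//|A0] := pselect (A !=set0).
  suff /A_max[] : A `<` B by [].
  split=> [x Ax|]; first by case: A0; exists x.
  by move=> BA; case: A0; exists w; apply: BA; have [] := gB.
(* By maximality, adjoining any element outside A brings in 1/w. *)
have adjoin y : ~ A y -> exists2 q : {poly L}, forall i, A q`_i & q.[y] = w^-1.
  move=> Ay; have [sAy AAy Ayy] := adjoin_subP sA y.
  have ltA : A `<` adjoin_sub A y by split=> // AyA; apply/Ay/AyA.
  have [[q]|no] := pselect (adjoin_sub A y w^-1); first by exists q.
  by case: (A_max _ ltA) => _; split=> //; apply: AAy.
(* Otherwise 1/w is a polynomial in 1/t with t = 1 - w b. Multiplying by a high power of t, which is
   1 modulo w, puts 1/w into A. *)
have unit1 b : A b -> A (1 - w * b)^-1.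
  move=> Ab; apply: contrapT => /adjoin[q Aq].
  set t := 1 - w * b => qt.
  have t0 : t != 0.
    rewrite subr_eq0; apply/eqP => wb; apply: Aw'.
    by rewrite -[w^-1]mulr1 wb mulrA mulVf ?mul1r.
  have At : A t by apply: (subalgB sA); [apply: subalg1 | apply: (subalgM sA)].
  have [c Ac tn] : exists2 c, A c & t ^+ size q = 1 - w * c.
    elim: (size q) => [|n [c Ac tn]].
      by exists 0; rewrite ?mulr0 ?subr0 //; apply: subalg0.
    exists (c + b - w * b * c); last by rewrite exprS tn /t; ring.
    by apply: (subalgB sA); [apply: subalgD | do 2?[apply: (subalgM sA)]].
  apply: Aw'; rewrite -[w^-1]mulr1 -(subrK (w * c) 1) -tn mulrDr mulrA mulVf //.
  rewrite mul1r -qt horner_coef mulr_suml; apply: (subalgD sA) => //.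
  apply: (subalg_sum sA) => i _; rewrite -mulrA; apply: (subalgM sA) => //.
  have -> : t ^+ size q = t ^+ (size q - i) * t ^+ i by rewrite -exprD subnK // ltnW.
  by rewrite exprVn mulrCA mulVf ?expf_neq0 // mulr1; apply: subalgX.
exists A; split=> //; split=> // y; apply: contrapT => /not_orP[/adjoin + /adjoin].
move=> [q Aq qy] [r Ar ry].
(* If neither y nor 1/y is in A, then 1/w is a polynomial both in y and in 1/y. The induction is on
   the total size of the two expressions, always shortening the longer one. *)
have [N leN] : exists N, (size q + size r <= N)%N by exists (size q + size r)%N.
elim: N => [|N IHN] in y q Aq qy r Ar ry leN *.
  move: leN qy; rewrite leqn0 addn_eq0 size_poly_eq0 => /andP[/eqP-> _] /eqP.
  by rewrite horner0 eq_sym invr_eq0 (negPf w0).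
have y0 : y != 0.
  apply/eqP => y_0; apply: Aw'; rewrite -qy y_0.
  by apply: (subalg_horner sA) => //; apply: subalg0.
wlog le_rq : y y0 q r Aq qy Ar ry leN / (size r <= size q)%N => [WL|].
  have [le_rq|/ltnW le_qr] := leqP (size r) (size q); first exact: (WL y _ q r).
  by apply: (WL y^-1 _ r q); rewrite ?invrK ?invr_eq0 // addnC.
case Dn: (size q) => [|n].
  move/eqP: Dn qy; rewrite size_poly_eq0 => /eqP-> /eqP.
  by rewrite horner0 eq_sym invr_eq0 (negPf w0).
(* Multiplying r(1/y) = 1/w by y^n writes y^n, thanks to the unit 1 - w r_0, as a combination of
   lower powers of y; [q'] is q after substituting this for y^n. *)
pose u := (1 - w * r`_0)^-1.
have u0 : 1 - w * r`_0 != 0.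
  rewrite subr_eq0; apply/eqP => wr; apply: Aw'.
  by rewrite -[w^-1]mulr1 wr mulrA mulVf ?mul1r.
pose q' := \poly_(i < n) (q`_i + q`_n * w * u * r`_(n - i)).
apply: (IHN y q' _ _ r) => //.
- move=> i; rewrite coef_poly; case: ifP => _; last exact: (subalg0 sA).
  by apply: (subalgD sA) => //; do 3?[apply: (subalgM sA) => //]; apply: unit1.
- rewrite -qy horner_poly (@horner_coef_wide _ n.+1 q) ?Dn // big_ord_recr /=.
  under eq_bigr do rewrite mulrDl; rewrite big_split /=; congr (_ + _).
  have: y ^+ n * (r.[y^-1] - r`_0) = \sum_(i < n) r`_(n - i) * y ^+ i.
    have lern : (size r <= n.+1)%N by rewrite -Dn.
    rewrite (horner_coef_wide _ lern) big_ord_recl /= expr0 mulr1.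
    rewrite addrAC subrr add0r mulr_sumr (reindex_inj rev_ord_inj) /=.
    apply: eq_bigr => i _; rewrite /bump /= add1n subnSK // mulrCA exprVn.
    rewrite -[in y ^+ n](subnK (leq_subr i n)) exprD subKn ?(ltnW (ltn_ord i)) //.
    by rewrite mulrK // unitfE expf_neq0.
  rewrite ry => E; under eq_bigr do rewrite -mulrA; rewrite -mulr_sumr -E.
  by rewrite mulrCA /u; field; rewrite w0 u0.
- by rewrite -ltnS (leq_trans _ leN) // ltn_add2r Dn ltnS size_poly.
Qed.

End ValuationRings.

(** * Discreteness of valuation rings *)

Section DiscreteValuationRings.
Variables (k L : fieldType) (iota : {rmorphism k -> L}).

(** The bound N for the degree of L over k(x), with denominators cleared. *)
Definition dependent_over (x : L) (N : nat) := forall y : 'I_N.+1 -> L,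
  exists2 c : 'I_N.+1 -> {poly k}, exists i, c i != 0 &
    \sum_i (map_poly iota (c i)).[x] * y i = 0.

Variable A : L -> Prop.
Hypothesis valA : valuation_subring iota A.

Let sA : subalgebra iota A. Proof. by case: valA. Qed.

Let inA1 := subalg1 sA.
Let inAM x y := @subalgM _ _ _ A sA x y.
Let inAX x n := @subalgX _ _ _ A sA x n.
Let inAD x y := @subalgD _ _ _ A sA x y.

Definition sub_unit x := [/\ x != 0, A x & A x^-1].

Definition sub_max x := A x /\ ~ sub_unit x.

Lemma sub_unitM x y : sub_unit x -> sub_unit y -> sub_unit (x * y).
Proof.
by move=> [? ? ?] [? ? ?]; split; rewrite ?mulf_neq0 ?invfM //; apply: inAM.
Qed.

Lemma sub_unitV x : sub_unit x -> sub_unit x^-1.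
Proof. by move=> [? ? ?]; split; rewrite ?invr_eq0 ?invrK. Qed.

Lemma sub_unitX x n : sub_unit x -> sub_unit (x ^+ n).
Proof. by move=> [? ? ?]; split; rewrite ?expf_neq0 -?exprVn //; apply: inAX. Qed.

Lemma sub_unit_const c : c != 0 -> sub_unit (iota c).
Proof. by move=> c0; split; rewrite ?fmorph_eq0 -?fmorphV //; case: sA. Qed.

Lemma sub_maxV x : x != 0 -> A x^-1 \/ sub_max x.
Proof.
move=> x0; have [|nAx] := pselect (A x^-1); [by left | right].
have [//|Ax] := valA.2 x; last by case: nAx.
by split=> // -[].
Qed.

Lemma sub_max_neq0 x : sub_max x -> x != 0 -> ~ A x^-1.
Proof. by move=> [Ax nux] x0 Ax'; apply: nux. Qed.

Lemma sub_max0 : sub_max 0.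
Proof. by split=> [|[/eqP]//]; apply: (subalg0 sA). Qed.

Lemma sub_maxMl x y : A x -> sub_max y -> sub_max (x * y).
Proof.
move=> Ax [Ay nuy]; split=> [|[]]; first exact: inAM.
rewrite mulf_eq0 => /norP[x0 y0] _ Axy; apply: nuy; split=> //.
by move: (inAM Ax Axy); rewrite invfM mulVKf.
Qed.

(** In a valuation ring one of x and y divides the other, so the sum is a multiple of one of
    them. *)
Lemma sub_maxD x y : sub_max x -> sub_max y -> sub_max (x + y).
Proof.
move=> mx my; have [->|x0] := eqVneq x 0; first by rewrite add0r.
have [->|y0] := eqVneq y 0; first by rewrite addr0.
have [Axy|Ayx] := valA.2 (x / y).
  have -> : x + y = (x / y + 1) * y by rewrite mulrDl divfK // mul1r.
  by apply/sub_maxMl/my/inAD.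
rewrite invf_div in Ayx.
have -> : x + y = (y / x + 1) * x by rewrite mulrDl divfK // mul1r addrC.
by apply/sub_maxMl/mx/inAD.
Qed.

Lemma sub_maxX x n : sub_max x -> sub_max (x ^+ n.+1).
Proof. by move=> mx; rewrite exprSr; apply/sub_maxMl/mx/inAX; case: mx. Qed.

Lemma sub_unitDl x y : sub_unit x -> sub_max y -> sub_unit (x + y).
Proof.
move=> ux my; apply: contrapT => nu; case: (ux) => _ Ax _.
have: sub_max (x + y) by split=> //; apply: inAD; last by case: my.
have AN1 : A (-1) by apply: (subalgN sA).
by move=> /sub_maxD-/(_ _ (sub_maxMl AN1 my)); rewrite mulN1r addrK => -[_ []].
Qed.

Section Uniformizer.
Variables (t : L) (N : nat).
Hypotheses (t0 : t != 0) (t_max : sub_max t) (depN : dependent_over t N).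

Lemma sub_unit_horner (q : {poly k}) :
  q`_0 != 0 -> sub_unit (map_poly iota q).[t].
Proof.
elim/poly_ind: q => [|q c _]; first by rewrite coef0 eqxx.
rewrite coefD coefMX coefC add0r /= => c0.
rewrite rmorphD rmorphM /= map_polyX map_polyC !hornerE addrC.
apply: sub_unitDl; first exact: sub_unit_const.
by apply/sub_maxMl/t_max/(subalg_map_horner sA); case: t_max.
Qed.

(** A relation over k[t] is divided by t until some coefficient has a non-zero constant term, that
    is, until its value at t is a unit. *)
Lemma dependent_normalized (y : 'I_N.+1 -> L) :
  exists2 c : 'I_N.+1 -> {poly k}, exists i, (c i)`_0 != 0 &
    \sum_i (map_poly iota (c i)).[t] * y i = 0.
Proof.
have [c c_ex c_sum] := depN y; case: c_ex => j cj0.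
have [n len] : exists n, (size (c j) <= n)%N by exists (size (c j)).
elim: n => [|n IHn] in c cj0 c_sum len *.
  by move: cj0; rewrite -size_poly_eq0 -leqn0 len.
have [ci0|/forallNP ci0] := pselect (exists i, (c i)`_0 != 0); first by exists c.
have {}ci0 i : c i = (drop_poly 1 (c i)) * 'X.
  rewrite -[c i in LHS](poly_take_drop 1) expr1 -[RHS]add0r; congr (_ + _).
  apply/polyP => -[|l]; rewrite coef_take_poly coef0 //=.
  by apply/eqP/negP => /negP; apply: ci0.
apply: (IHn (fun i => drop_poly 1 (c i))).
- by apply: contraNneq cj0 => dj0; rewrite ci0 dj0 mul0r.
- apply: (mulIf t0); rewrite mul0r -[RHS]c_sum mulr_suml; apply: eq_bigr => i _.
  by rewrite [c i in RHS]ci0 rmorphM /= map_polyX hornerM hornerX mulrAC.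
- by rewrite size_drop_poly leq_subLR add1n.
Qed.

(* The valuations of the [y i] increase strictly and stay below that of [t], so
   they are linearly independent over [k[t]]. *)
Lemma chain_bound (y : nat -> L) :
  (forall i, (i <= N)%N -> y i != 0 /\ A (y i)) ->
  (forall i j, (i < j)%N -> (j <= N)%N -> sub_max (y j / y i)) ->
  (forall i, (i <= N)%N -> sub_max (t / y i)) -> False.
Proof.
move=> y0 y_chain yt.
have [c c_ex c_sum] := dependent_normalized (fun i => y i).
case: c_ex => i0 ci0.
(* For the least such i, division by y_i turns the i-th term into a unit. The other terms fall into
   the maximal ideal: through y_j / y_i if j > i, and through t / y_i if the coefficient is
   divisible by t. *)
case: (@arg_minnP _ i0 (fun i => (c i)`_0 != 0) val ci0) => {i0 ci0}i ci0 i_min.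
have leN (j : 'I_N.+1) : (j <= N)%N by rewrite -ltnS.
have [yi0 Ayi] := y0 i (leN i).
move: c_sum; rewrite (bigD1 i) //= => /(congr1 (fun z => z / y i)).
rewrite mul0r mulrDl mulfK // mulr_suml => c_sum.
set b := \sum_(_ | _) _ in c_sum.
suff /(sub_unitDl (sub_unit_horner ci0))[] : sub_max b by rewrite c_sum eqxx.
rewrite /b; elim/big_ind: _ => [|x y'|j ne_ji].
- exact: sub_max0.
- exact: sub_maxD.
have At : A t by case: t_max.
have [cj0|cj0] := eqVneq ((c j)`_0) 0; last first.
  rewrite -mulrA; apply: sub_maxMl; first exact: (subalg_map_horner sA).
  by apply: (y_chain _ _ _ (leN j)); rewrite ltn_neqAle eq_sym ne_ji i_min.
have -> : c j = (drop_poly 1 (c j)) * 'X.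
  rewrite -[c j in LHS](poly_take_drop 1) expr1 -[RHS]add0r; congr (_ + _).
  by apply/polyP => -[|l]; rewrite coef_take_poly coef0 //=.
rewrite rmorphM /= map_polyX hornerM hornerX -!mulrA; apply: sub_maxMl.
  exact: (subalg_map_horner sA).
rewrite mulrCA; apply: sub_maxMl; first by case: (y0 j (leN j)).
exact: yt.
Qed.

Lemma power_bound u n : u != 0 -> sub_max u -> A (t / u ^+ n) -> (n <= N)%N.
Proof.
move=> u0 mu Atu; rewrite leqNgt; apply/negP => ltNn.
have Au : A u by case: mu.
apply: (@chain_bound (fun i => u ^+ i)) => [i _|i j lt_ij _|i lei].
- by rewrite expf_neq0 //; split=> //; apply: inAX.
- rewrite -(subnKC (ltnW lt_ij)) exprD mulrAC divff ?expf_neq0 // mul1r.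
  by rewrite -(subnSK lt_ij); apply: sub_maxX.
- have lt_in := leq_ltn_trans lei ltNn.
  have -> : t / u ^+ i = t / u ^+ n * u ^+ (n - i).
    by rewrite -(subnK (ltnW lt_in)) exprD addnK; field; rewrite !expf_neq0.
  by rewrite -(subnSK lt_in); apply/sub_maxMl/sub_maxX.
Qed.

(* A divisor [u] of [t] in the maximal ideal with [u^(n+1) | t] for the largest
   possible [n] generates the maximal ideal: otherwise [u] would be divisible by
   the square of an element of the maximal ideal. *)
Lemma uniformizer_exists :
  exists u, [/\ u != 0, sub_max u & forall z, sub_max z -> A (z / u)].
Proof.
have At : A t by case: t_max.
pose B n := `[< exists u, [/\ u != 0, sub_max u & A (t / u ^+ n.+1)] >].
have exB : exists n, B n by exists 0; apply/asboolP; exists t; rewrite divff.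
have ltB n : B n -> (n <= N)%N.
  by move=> /asboolP[u [u0 mu Atu]]; apply/ltnW/(power_bound u0 mu Atu).
have [n /asboolP[u [u0 mu Atu]] n_max] := ex_maxnP exB ltB.
exists u; split=> // z mz; have [->|z0] := eqVneq z 0.
  by rewrite mul0r; apply: (subalg0 sA).
apply: contrapT => nAzu.
have mz' : sub_max (u / z).
  have uz0 : u / z != 0 by rewrite mulf_neq0 ?invr_eq0.
  by have [|//] := sub_maxV uz0; rewrite invf_div.
have no_square y : y != 0 -> sub_max y -> ~ A (u / y ^+ 2).
  move=> y0 my Auy; suff /n_max : B n.*2.+1 by rewrite leqNgt -addnn ltnS leq_addr.
  apply/asboolP; exists y; split=> //.
  have -> : t / y ^+ n.*2.+2 = t / u ^+ n.+1 * (u / y ^+ 2) ^+ n.+1.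
    rewrite expr_div_n -exprM mul2n doubleS; field.
    by rewrite !expf_neq0.
  by apply/inAM/inAX.
have [Azz|Azz] := valA.2 (u / z ^+ 2); first exact: (no_square z).
apply: (no_square (u / z)) => //; first by rewrite mulf_neq0 ?invr_eq0.
rewrite invf_div in Azz; suff -> : u / (u / z) ^+ 2 = z ^+ 2 / u by [].
by field; rewrite u0 z0.
Qed.

(** An element z of A divisible by all powers of u would divide the lowest non-zero coefficient of a
    relation between its powers. That coefficient is a power of t times a unit, and t is a power of
    u times a unit, which is a contradiction. *)
Lemma uniformizer_power u : u != 0 -> sub_max u ->
    (forall z, sub_max z -> A (z / u)) ->
  forall z, z != 0 -> exists i : int, sub_unit (z / u ^ i).
Proof.
move=> u0 mu u_gen.
have Au : A u by case: mu.
have powers z : z != 0 -> A z -> (exists n, ~ A (z / u ^+ n)) ->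
    exists n : nat, sub_unit (z / u ^+ n).
  move=> z0 Az [n nAzn]; elim: n => [|n IHn] in nAzn *.
    by case: nAzn; rewrite divr1.
  have [Azn|/IHn//] := pselect (A (z / u ^+ n)).
  exists n; apply: contrapT => nuz; apply: nAzn.
  by rewrite exprSr invfM mulrA; apply: u_gen.
have t_bound : exists n, ~ A (t / u ^+ n).
  by exists N.+1 => /(power_bound u0 mu); rewrite ltnn.
have At : A t by case: t_max.
have [n0 ut] := powers t t0 At t_bound.
suff powersA z : z != 0 -> A z -> exists n : nat, sub_unit (z / u ^+ n).
  move=> z z0; have [/(powersA _ z0)[n uz]|Az'] := valA.2 z; first by exists n.
  have [|n uz] := powersA z^-1 _ Az'; first by rewrite invr_eq0.
  exists (- n%:Z); rewrite -invr_expz invrK -[_ * _]invrK invfM.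
  exact: sub_unitV.
move=> z0 Az; apply: powers => //; apply: contrapT => /forallNP Azu.
have {}Azu n : A (z / u ^+ n) by apply: contrapT.
have [c c_ex c_sum] := depN (fun i => z ^+ i); case: c_ex => i0 ci0.
case: (@arg_minnP _ i0 (fun i => c i != 0) val ci0) => {i0 ci0}i ci0 i_min.
have Actz : A ((map_poly iota (c i)).[t] / z).
  move: c_sum; rewrite (bigD1 i) //= => /(congr1 (fun x => x / z ^+ i.+1)).
  rewrite mul0r mulrDl mulr_suml => /eqP; rewrite addr_eq0 => /eqP c_sum.
  have -> : (map_poly iota (c i)).[t] / z =
      (map_poly iota (c i)).[t] * z ^+ i / z ^+ i.+1.
    by rewrite exprS; field; rewrite z0 expf_neq0.
  rewrite c_sum; apply/(subalgN sA)/(subalg_sum sA) => j ne_ji.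
  have [->|cj0] := eqVneq (c j) 0.
    by rewrite rmorph0 horner0 !mul0r; apply: (subalg0 sA).
  rewrite -mulrA; apply: inAM; first exact: (subalg_map_horner sA).
  have ltij : (i < j)%N by rewrite ltn_neqAle eq_sym ne_ji i_min.
  by rewrite -(subnK ltij) exprD mulfK ?expf_neq0 //; apply: inAX.
have [s [q q0 Dc]] := multiplicity_XsubC (c i) 0.
rewrite ci0 subr0 /root horner_coef0 in q0 Dc.
have [qt0 _ Aq'] := sub_unit_horner q0.
have Atz : A (t ^+ s / z).
  have -> : t ^+ s / z = (map_poly iota (c i)).[t] / z / (map_poly iota q).[t].
    rewrite Dc rmorphM rmorphXn /= map_polyX hornerM hornerXn; field.
    by rewrite qt0 z0.
  exact: inAM.
have {Atz}Atu n : A (t ^+ s / u ^+ n).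
  have -> : t ^+ s / u ^+ n = (t ^+ s / z) * (z / u ^+ n) by rewrite mulrA divfK.
  exact: inAM.
have [_ _ Aut'] := sub_unitX s ut.
apply: (sub_max_neq0 mu u0).
have -> : u^-1 = t ^+ s / u ^+ (n0 * s).+1 * ((t / u ^+ n0) ^+ s)^-1.
  by rewrite expr_div_n -exprM exprS; field; rewrite u0 !expf_neq0.
exact: inAM.
Qed.

End Uniformizer.
End DiscreteValuationRings.

(** * Zeros of non-constant functions *)

Section Constants.

(** The order of y is the exponent z for which y / u^z is a unit; it is unique because u^z lies in A
    only for z >= 0. *)
Lemma valuation_point (k L : fieldType) (iota : {rmorphism k -> L})
    (A : L -> Prop) (u : L) : valuation_subring iota A -> u != 0 ->
    sub_max A u ->
    (forall z, z != 0 -> exists i : int, sub_unit A (z / u ^ i)) ->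
  exists Q : point iota, forall y, A y -> ~ A y^-1 -> 0 < Q y.
Proof.
move=> valA u0 mu u_gen; have [sA AV] := valA.
have Au : A u by case: mu.
have uz z : u ^ z != 0 by rewrite expfz_neq0.
have AuzP (z : int) : A (u ^ z) <-> 0 <= z.
  case: z => n; first by split=> // _; apply: (subalgX sA).
  split=> // AuN; case: (sub_max_neq0 mu u0).
  suff -> : u^-1 = u ^ Negz n * u ^+ n by apply/(subalgM sA)/(subalgX sA).
  by rewrite NegzE -exprnN exprS; field; rewrite u0 expf_neq0.
pose v y : int := if pselect (y != 0) is left y0 then sval (cid (u_gen y y0)) else 0.
have vP y : y != 0 -> sub_unit A (y / u ^ v y).
  by rewrite /v => y0; case: pselect => // y0'; case: cid.
have vleP y (z : int) : y != 0 -> A (y / u ^ z) <-> z <= v y.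
  move=> y0; have [_ Ay Ay'] := vP y y0; rewrite -subr_ge0 -AuzP expfzDr // -invr_expz.
  split=> Az.
    have -> : u ^ v y * (u ^ z)^-1 = (y / u ^ z) * (y / u ^ v y)^-1.
      by field; rewrite y0 !uz.
    exact: (subalgM sA).
  have -> : y / u ^ z = (y / u ^ v y) * (u ^ v y / u ^ z) by field; rewrite !uz.
  exact: (subalgM sA).
have vE y (z : int) : sub_unit A (y / u ^ z) -> v y = z.
  move=> [yz Ay Ay']; have y0 : y != 0 by apply: contraNneq yz => ->; rewrite mul0r.
  have [_ Avy _] := vP y y0.
  apply: le_anti; apply/andP; split; last exact/vleP.
  rewrite -subr_ge0 -AuzP expfzDr // -invr_expz.
  have -> : u ^ z * (u ^ v y)^-1 = (y / u ^ z)^-1 * (y / u ^ v y).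
    by field; rewrite y0 !uz.
  exact: (subalgM sA).
have v0 : v 0 = 0 by rewrite /v; case: pselect => // y0; case/eqP: (y0).
have vM f g : f != 0 -> g != 0 -> v (f * g) = v f + v g.
  move=> f0 g0; apply: vE; rewrite expfzDr // -mulf_div.
  by apply: (sub_unitM valA); apply: vP.
have vD f g : f != 0 -> g != 0 -> f + g != 0 -> Num.min (v f) (v g) <= v (f + g).
  move=> f0 g0 fg0; apply/vleP => //; rewrite mulrDl; apply: (subalgD sA).
    by apply/vleP; rewrite // ge_min lexx.
  by apply/vleP; rewrite // ge_min lexx orbT.
have vc c : c != 0 -> v (iota c) = 0.
  by move=> c0; apply: vE; rewrite expr0z divr1; apply: (sub_unit_const valA).
have vu : exists f, v f == 1.
  exists u; apply/eqP/vE; rewrite expr1z divff //.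
  by split; rewrite ?oner_eq0 ?invr1 //; apply: (subalg1 sA).
exists (Point v0 vM vD vc vu) => y /= Ay nAy.
have y0 : y != 0.
  apply: contra_notN nAy => /eqP y0; rewrite -[y^-1]mulr1 y0 invr0 mul0r.
  exact: (subalg0 sA).
rewrite lt_neqAle; apply/andP; split; last by apply/vleP; rewrite // expr0z divr1.
apply/eqP => vy0; have [_ _] := vP y y0; rewrite -vy0 expr0z divr1; exact: nAy.
Qed.

(** Over an algebraically closed field a non-constant w is transcendental, so 1/w is not a
    polynomial in w and some valuation ring has w in its maximal ideal. *)
Lemma nonconstant_zero (k : closedFieldType) (L : fieldType)
    (iota : {rmorphism k -> L}) (x : L) (N : nat) (w : L) :
    (forall p : {poly k}, p != 0 -> (map_poly iota p).[x] != 0) ->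
    dependent_over iota x N -> w != 0 -> (forall c, w != iota c) ->
  exists Q : point iota, 0 < Q w.
Proof.
move=> x_transc depN w0 w_nonconst.
have w_transc p : p != 0 -> (map_poly iota p).[w] != 0.
  move=> p0; have [rs ->] := closed_field_poly_normal p.
  rewrite map_polyZ /= hornerZ mulf_neq0 ?fmorph_eq0 ?lead_coef_eq0 //.
  rewrite rmorph_prod horner_prod; elim/big_ind: _ => [|a b|c _].
  - exact: oner_neq0.
  - exact: mulf_neq0.
  by rewrite rmorphB /= map_polyX map_polyC /= hornerXsubC subr_eq0.
have [|A [valA Aw nAw]] := @exists_valuation_subring _ _ iota w w0.
  move=> p; apply/eqP => pw; have: p * 'X - 1 != 0.
    rewrite subr_eq0; apply/eqP => /(congr1 (fun q : {poly k} => q.[0])).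
    by rewrite !hornerE => /eqP; rewrite eq_sym oner_eq0.
  move=> /w_transc; rewrite rmorphB rmorphM rmorph1 /= map_polyX !hornerE pw.
  by rewrite mulVf // subrr eqxx.
have [sA AV] := valA.
have mw : sub_max A w by split=> // -[].
(* The maximal ideal contains [x - a] for some constant [a], or [1 / x]; linear
   dependence over [k[x]] then gives linear dependence over [k[t]]. *)
suff [t [t0 mt depNt]] : exists t, [/\ t != 0, sub_max A t & dependent_over iota t N].
  have [u [u0 mu u_gen]] := uniformizer_exists valA t0 mt depNt.
  have [//|Q AQ] := valuation_point valA u0 mu.
    exact: (uniformizer_power valA t0 mt depNt).
  by exists Q; apply: AQ.
have [Ax|nAx] := pselect (A x); last first.
  have Ax' : A x^-1 by case: (AV x).
  have x0 : x != 0 by apply: contra_notN nAx => /eqP->; apply: (subalg0 sA).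
  exists x^-1; split; rewrite ?invr_eq0 //; first by split=> // -[_ _]; rewrite invrK.
  move=> y; have [c c_ex c_sum] := depN y.
  (* The reversed polynomial at 1/x, times x^(T-1), is c_i(x); the common bound T lets one power of
     x serve all i. *)
  pose T := \max_i size (c i); have leT i : (size (c i) <= T)%N by apply: leq_bigmax.
  exists (fun i => \poly_(j < T) (c i)`_(T - j.+1)).
    case: c_ex => i ci0; exists i; apply: contra ci0 => /eqP/polyP ci0.
    apply/eqP/polyP => j; rewrite coef0; have [leTj|ltjT] := leqP T j.
      by rewrite nth_default // (leq_trans (leT i)).
    have := ci0 (T - j.+1)%N; rewrite coef_poly coef0 -subSn // subSS leq_subr.
    by rewrite subKn // ltnW.
  have [T0|T_gt0] := posnP T.
    by rewrite T0 big1 // => i _; rewrite poly_def big_ord0 rmorph0 horner0 mul0r.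
  apply: (mulfI (expf_neq0 T.-1 x0)); rewrite mulr0 -[RHS]c_sum mulr_sumr.
  apply: eq_bigr => i _; rewrite mulrA; congr (_ * _).
  have hornerT (p : {poly k}) z : (size p <= T)%N ->
      (map_poly iota p).[z] = \sum_(j < T) (map_poly iota p)`_j * z ^+ j.
    by move=> lepT; rewrite -horner_coef_wide // size_map_poly.
  rewrite !hornerT ?size_poly //.
  rewrite mulr_sumr (reindex_inj rev_ord_inj) /=; apply: eq_bigr => j _.
  rewrite !coef_map coef_poly /= -subSn // subSS leq_subr.
  rewrite subKn ?(ltnW (ltn_ord j)) // mulrCA.
  have -> : x ^+ T.-1 = x ^+ j * x ^+ (T - j.+1).
    by rewrite -exprD -[T in LHS](subnKC (ltn_ord j)) addSn.
  by rewrite exprVn mulfK ?expf_neq0.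
have [c c_ex c_sum] := depN (fun i => w ^+ i); case: c_ex => i0 ci0.
case: (@arg_minnP _ i0 (fun i => c i != 0) val ci0) => {i0 ci0}i ci0 i_min.
(* After division by w^i, the lowest non-zero coefficient c_i(x) is a multiple of w. Hence it lies
   in the maximal ideal, and so does one of its linear factors. *)
have mci : sub_max A (map_poly iota (c i)).[x].
  move: c_sum; rewrite (bigD1 i) //= => /(congr1 (fun z => z / w ^+ i)).
  rewrite mul0r mulrDl mulfK ?expf_neq0 // mulr_suml => /eqP.
  rewrite addr_eq0 -sumrN => /eqP->; elim/big_ind: _ => [|y z|j ne_ji].
  - exact: (sub_max0 valA).
  - exact: (sub_maxD valA).
  have [->|cj0] := eqVneq (c j) 0.
    by rewrite rmorph0 horner0 !mul0r oppr0; apply: (sub_max0 valA).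
  have ltij : (i < j)%N by rewrite ltn_neqAle eq_sym ne_ji i_min.
  rewrite -mulrA -mulNr; apply: (sub_maxMl valA).
    by apply/(subalgN sA)/(subalg_map_horner sA).
  rewrite -(subnKC (ltnW ltij)) exprD mulrAC divff ?expf_neq0 // mul1r -subnSK //.
  exact: (sub_maxX valA).
have [a ma] : exists a, sub_max A (x - iota a).
  apply: contrapT => /forallNP nma; case: mci => _ [].
  have [rs ->] := closed_field_poly_normal (c i).
  rewrite map_polyZ /= hornerZ; apply: (sub_unitM valA).
    by apply: (sub_unit_const valA); rewrite lead_coef_eq0.
  rewrite rmorph_prod horner_prod; elim/big_ind: _ => [|y z|a _].
  - by split; rewrite ?oner_eq0 ?invr1 //; apply: (subalg1 sA).
  - exact: (sub_unitM valA).
  rewrite rmorphB /= map_polyX map_polyC /= hornerXsubC.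
  apply: contrapT => nu; apply: (nma a); split=> //.
  by apply: (subalgB sA) => //; case: sA.
have xa0 : x - iota a != 0.
  have := x_transc ('X - a%:P); rewrite polyXsubC_eq0 => /(_ isT).
  by rewrite rmorphB /= map_polyX map_polyC /= hornerXsubC.
exists (x - iota a); split=> // y.
have [d d_ex d_sum] := depN y; exists (fun j => d j \Po ('X + a%:P)).
  case: d_ex => j dj0; exists j; rewrite comp_poly_eq0 //.
  by rewrite size_XaddC.
rewrite -[RHS]d_sum; apply: eq_bigr => j _; congr (_ * _).
by rewrite map_comp_poly horner_comp rmorphD /= map_polyX map_polyC !hornerE subrK.
Qed.

End Constants.

(** * Function fields and finite extensions *)

Section FunctionFields.

(** Padding the rows with a zero column gives a singular square matrix, whose left kernel contains a
    non-zero vector without denominators. *)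
Lemma dependent_rows (D : idomainType) (I : finType) (p : 'I_#|I|.+1 -> I -> D) :
  exists2 v : 'I_#|I|.+1 -> D, exists i, v i != 0 &
    forall l, \sum_i v i * p i l = 0.
Proof.
pose M : 'M[D]_#|I|.+1 :=
  \matrix_(i, j) oapp (fun l : 'I_#|I| => p i (enum_val l)) 0 (insub (val j)).
have : \det M == 0.
  rewrite (expand_det_col _ ord_max) big1 // => i _.
  by rewrite mxE insubF ?mul0r //= ltnn.
case/det0P => v v0 vM; exists (fun i => v 0 i) => [|l]; first exact/rV0Pn.
have /rowP/(_ (widen_ord (leqnSn _) (enum_rank l))) := vM.
rewrite !mxE => vMl; rewrite -[RHS]vMl; apply: eq_bigr => i _; rewrite mxE /=.
by rewrite valK /= enum_rankK.
Qed.

(** The finiteness condition in [function_field], with an arbitrary finite index type so that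
    products of generators can be indexed by pairs. *)
Definition poly_spanned (k L : fieldType) (iota : {rmorphism k -> L}) (x : L) :=
  exists (I : finType) (e : I -> L), forall y, exists q p, q != 0 /\
    (map_poly iota q).[x] * y = \sum_i (map_poly iota (p i)).[x] * e i.

Lemma poly_spanned_dependent (k L : fieldType) (iota : {rmorphism k -> L}) x :
  poly_spanned iota x -> exists N, dependent_over iota x N.
Proof.
move=> [I [e e_span]]; exists #|I| => y.
have /choice[q /choice[p pq]] : forall i, exists q, exists p, q != 0 /\
    (map_poly iota q).[x] * y i = \sum_i (map_poly iota (p i)).[x] * e i.
  by move=> i; apply: e_span.
have [v [i0 vi0] v_rel] := dependent_rows p.
exists (fun i => v i * q i); first by exists i0; rewrite mulf_neq0 //; case: (pq i0).
under eq_bigr => i _.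
  rewrite rmorphM hornerM -mulrA; case: (pq i) => _ ->.
  rewrite mulr_sumr; under eq_bigr do rewrite mulrA -hornerM -rmorphM.
over.
rewrite exchange_big big1 //= => l _; rewrite -mulr_suml.
by rewrite -horner_sum -rmorph_sum v_rel rmorph0 horner0 mul0r.
Qed.

Variables (k K L : fieldType) (iota : {rmorphism k -> K}).
Variable (phi : {rmorphism K -> L}).

Definition finite_ext := exists (J : finType) (f : J -> L),
  forall y, exists c : J -> K, y = \sum_j phi (c j) * f j.

Lemma horner_ext (p : {poly k}) (x : K) :
  (map_poly (ext_const iota phi) p).[phi x] = phi (map_poly iota p).[x].
Proof. by rewrite map_poly_comp horner_map. Qed.

Lemma finite_ext_spanned (x : K) : finite_ext -> poly_spanned iota x ->
  poly_spanned (ext_const iota phi) (phi x).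
Proof.
move=> [J [f f_span]] [I [e e_span]].
exists (I * J)%type, (fun ij => phi (e ij.1) * f ij.2) => y.
have [c ->] := f_span y.
have /choice[q /choice[p pq]] : forall j, exists q, exists p, q != 0 /\
    (map_poly iota q).[x] * c j = \sum_i (map_poly iota (p i)).[x] * e i.
  by move=> j; apply: e_span.
exists (\prod_j q j), (fun ij => (\prod_(j | j != ij.2) q j) * p ij.2 ij.1).
split; first by apply/prodf_neq0 => j _; case: (pq j).
rewrite (eq_bigl (fun ij => xpredT ij.1 && xpredT ij.2)) //.
rewrite -(pair_big xpredT xpredT (fun i j => (map_poly (ext_const iota phi)
  (\prod_(j' | j' != j) q j' * p j i)).[phi x] * (phi (e i) * f j))) /=.
rewrite exchange_big mulr_sumr /=; apply: eq_bigr => j _.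
rewrite (bigD1 j) //=.
under [RHS]eq_bigr do
  rewrite horner_ext rmorphM /= hornerM mulrA -rmorphM -mulrA.
rewrite -mulr_suml -rmorph_sum -mulr_sumr; case: (pq j) => _ <-.
rewrite horner_ext [map_poly iota (_ * _)]rmorphM /= hornerM !rmorphM /=. ring.
Qed.

Lemma finite_ext_algebraic : finite_ext -> algebraic_ext phi.
Proof.
move=> [J [f f_span]] y.
have /choice[c cE] : forall i : 'I_#|J|.+1, exists c : J -> K,
    y ^+ i = \sum_j phi (c j) * f j by move=> i; apply: f_span.
have [v [i0 vi0] v_rel] := dependent_rows c.
exists (\poly_(i < #|J|.+1) v (inord i)).
  apply: contraNneq vi0 => /polyP/(_ i0).
  by rewrite coef_poly ltn_ord inord_val coef0 => ->.
apply/rootP; rewrite (@horner_coef_wide _ #|J|.+1) ?size_map_poly ?size_poly //.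
under eq_bigr => i _.
  rewrite coef_map coef_poly ltn_ord inord_val cE mulr_sumr /=.
  under eq_bigr do rewrite mulrA -rmorphM.
over.
rewrite exchange_big big1 //= => j _.
by rewrite -mulr_suml -rmorph_sum v_rel rmorph0 mul0r.
Qed.

End FunctionFields.
(** * Torsion classes and the Gauss lemma *)

Section TorsionClasses.
Variables (k : closedFieldType) (K L : fieldType) (iota : {rmorphism k -> K}).
Variable (phi : {rmorphism K -> L}).
Hypotheses (curveK : function_field iota) (phi_fin : finite_ext phi).

Lemma ord_eq0_const w : w != 0 ->
    (forall Q : point (ext_const iota phi), Q w = 0) ->
  exists c, w = ext_const iota phi c.
Proof.
move=> w0 Qw; apply: contrapT => /forallNP w_nonconst.
have [x [x_transc [e e_span]]] := curveK.
have spanK : poly_spanned iota x.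
  exists 'I_(size e), (fun i : 'I_(size e) => e`_i) => y; have [q [p [q0 pq]]] := e_span y.
  by exists q, (fun i : 'I_(size e) => p i).
have [N depN] := poly_spanned_dependent (finite_ext_spanned phi_fin spanK).
have [||||Q] := @nonconstant_zero k L (ext_const iota phi) (phi x) N w => //.
- by move=> p p0; rewrite horner_ext fmorph_eq0 x_transc.
- by move=> c; apply/eqP/w_nonconst.
- by rewrite Qw ltxx.
Qed.

Lemma class_eqP (D D' : divisor iota) : class D = class D' <->
  exists2 f : K, f != 0 & forall P, mult_at D P = mult_at D' P + P f.
Proof.
split=> [/eqP|[f f0 DD']]; last apply/eqP.
  rewrite /class -Quotient.idealrBE => /asboolP[f f0 DD'].
  by exists f => // P; rewrite -DD' /mult_at coeffB addrC subrK.
rewrite /class -Quotient.idealrBE; apply/asboolP; exists f => // P.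
by rewrite /mult_at coeffB -!/(mult_at _ _) DD' addrC addKr.
Qed.

Lemma class_mulrz (D : divisor iota) (z : int) : class (D *~ z) = class D *~ z.
Proof. exact: (raddfMz (\pi_(Quotient.quot (@principal _ _ iota)))). Qed.

Lemma mult_at_mulrz (D : divisor iota) (z : int) P :
  mult_at (D *~ z) P = mult_at D P *~ z.
Proof. exact: (raddfMz (coeff P)). Qed.

Lemma Pic0_mulrz (c : Pic iota) (z : int) : Pic0 c -> Pic0 (c *~ z).
Proof.
move=> [D <- D0]; exists (D *~ z); first exact: class_mulrz.
by rewrite raddfMz /= D0 mul0rz.
Qed.

Variables (E : divisor iota) (h : K) (d : nat).
Hypotheses (h0 : h != 0) (hE : forall P : point iota, P h = mult_at E P *+ d).
Hypothesis (d_gt0 : (0 < d)%N).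

Lemma ker_pullback_root (m : nat) : ker_pullback phi (class E *+ m) ->
  exists v : L, v ^+ d = phi (h ^+ m).
Proof.
move=> [_ [D D_E [f f0 fD]]].
(* D is only linearly equivalent to m E; x accounts for the difference. *)
have [x x0 DE] : exists2 x : K, x != 0 &
    forall P, mult_at D P = mult_at E P *+ m + P x.
  move: D_E; rewrite pmulrn -class_mulrz => /class_eqP[x x0 DE].
  by exists x => // P; rewrite DE mult_at_mulrz.
(* [w] has neither zeros nor poles. *)
pose w := (f / phi x) ^+ d / phi (h ^+ m).
have fx0 : f / phi x != 0 by rewrite mulf_neq0 ?invr_eq0 ?fmorph_eq0.
have hm0 : phi (h ^+ m) != 0 by rewrite fmorph_eq0 expf_neq0.
have w0 : w != 0 by rewrite mulf_neq0 ?invr_eq0 ?expf_neq0.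
have [Q|c Dw] := ord_eq0_const w0.
  have [P [e [_ e0 QP QD]]] := pullbackE (finite_ext_algebraic phi_fin) Q.
  rewrite ordM ?expf_neq0 ?invr_eq0 // ordV // ordX // ordM ?invr_eq0 ?fmorph_eq0 //.
  rewrite ordV ?fmorph_eq0 // -fD QD !QP ?expf_neq0 // ordX // DE hE.
  rewrite -mulrBr addrK mulrnAr -mulrnA; apply/eqP; rewrite subr_eq0; apply/eqP.
  by rewrite -!mulrnAr -!mulrnA mulnC.
have c0 : c != 0 by apply: contraNneq w0 => c0; rewrite Dw c0 rmorph0.
have [r rd] : exists r, r ^+ d = c.
  have := @solve_monicpoly k d (fun i => c *+ (i == 0)%N) d_gt0.
  case=> r rd; exists r; rewrite rd; case: (d) d_gt0 => // d' _; rewrite big_ord_recl.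
  by rewrite big1 => [|i _]; rewrite ?mul0r // expr0 mulr1 addr0.
exists (f / phi x / ext_const iota phi r).
rewrite expr_div_n -[ext_const iota phi r ^+ d]rmorphXn rd -Dw /w invf_div.
by rewrite mulrCA divff ?mulr1 // expf_neq0.
Qed.

(** The divisor of v is m times the pullback of E, because the integers have no d-torsion. The
    multiple z is there to reach every element of Gamma from its generator. *)
Lemma root_ker_pullback (m : nat) (v : L) (z : int) :
    v ^+ d = phi (h ^+ m) -> Pic0 (class E *~ z) ->
  ker_pullback phi (class E *~ z *+ m).
Proof.
move=> vd Ez; split; first by rewrite pmulrn; apply: Pic0_mulrz.
exists (E *~ z *~ m); first by rewrite !class_mulrz.
have v0 : v != 0.
  have: v ^+ d != 0 by rewrite vd fmorph_eq0 expf_neq0.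
  by rewrite expf_eq0 d_gt0.
exists (v ^ z) => [|Q]; first by rewrite expfz_neq0.
have [P [e [_ e0 QP QD]]] := pullbackE (finite_ext_algebraic phi_fin) Q.
rewrite QD ordXz // !mult_at_mulrz.
have: Q v *+ d = (e * mult_at E P *+ m) *+ d.
  by rewrite -ordX // vd QP ?expf_neq0 // ordX // hE -!mulrnAr -!mulrnA mulnC.
move=> /eqP; rewrite eqr_pMn2r // => /eqP->.
by rewrite !mulrzAr pmulrn -!mulrzA [z * _]mulrC.
Qed.

End TorsionClasses.

(** * Gauss lemma with a weight on the variable *)

Section GaussLemma.
Variables (k K : fieldType) (iota : {rmorphism k -> K}) (P : point iota) (mu : int).

(** W is the Gauss valuation of r when the variable is given the order -mu, and i0 is the first
    index at which it is attained. *)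
Lemma gauss_min (r : {poly K}) : r != 0 -> exists (W : int) (i0 : nat),
  [/\ r`_i0 != 0, P r`_i0 = W + mu *+ i0,
      forall i, ord_ge P (W + mu *+ i) r`_i
    & forall i, (i < i0)%N -> ord_ge P (W + mu *+ i + 1) r`_i].
Proof.
move=> r0; have lt_lead : ((size r).-1 < size r)%N by rewrite prednK ?size_poly_gt0.
pose w (i : 'I_(size r)) := P r`_i - mu *+ i.
have lead0 : r`_(Ordinal lt_lead) != 0 by rewrite /= -lead_coefE lead_coef_eq0.
have [i1 /= ri1 w_min] :=
  Order.TotalTheory.arg_minP (P := fun i : 'I__ => r`_i != 0) w lead0.
pose A i := (r`_i != 0) && (P r`_i == w i1 + mu *+ i).
have exA : exists i, A i by exists i1; rewrite /A ri1 /w subrK eqxx.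
case: (ex_minnP exA) => i0 /andP[ri0 /eqP Pi0] i0_min.
have geW i : ord_ge P (w i1 + mu *+ i) r`_i.
  move=> ri; have lti : (i < size r)%N.
    by rewrite ltnNge; apply: contra ri => /(nth_default 0)->.
  by rewrite -lerBrDr; apply: (w_min (Ordinal lti)).
exists (w i1), i0; split=> // i lti ri; rewrite lezD1 lt_neqAle geW // andbT.
rewrite eq_sym; apply: contraTN lti => Pi.
by rewrite -leqNgt i0_min // /A ri.
Qed.

(** The Gauss valuation is multiplicative, since in the coefficient of index i0 + j0 a single
    product has minimal order. A monic polynomial has valuation at most -mu times its degree, so
    equality for the product forces equality for each factor. *)
Lemma gauss_monic (p q : {poly K}) : p \is monic -> q \is monic ->
    (forall i, ord_ge P (mu *~ (i%:Z - (size (p * q)).-1%:Z)) (p * q)`_i) ->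
  forall i, ord_ge P (mu *~ (i%:Z - (size p).-1%:Z)) p`_i.
Proof.
move=> p_monic q_monic ge_pq i.
have gauss_lead (r : {poly K}) W : r \is monic ->
    (forall i, ord_ge P (W + mu *+ i) r`_i) -> W <= - (mu *+ (size r).-1).
  move=> r_monic /(_ (size r).-1); rewrite -lead_coefE (monicP r_monic).
  by move=> /(_ (oner_neq0 _)); rewrite ord1 -lerBrDr sub0r.
have [W [i0 [pi0 Pi0 geW gtW]]] := gauss_min (monic_neq0 p_monic).
have [W' [j0 [qj0 Pj0 geW' gtW']]] := gauss_min (monic_neq0 q_monic).
have leW' := gauss_lead q W' q_monic geW'.
suff leW : - (mu *+ (size p).-1) <= W.
  apply: ord_geW (geW i); rewrite mulrzBr -pmulrn -pmulrn addrC.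
  by rewrite lerD2r.
have {}ge_pq := ge_pq (i0 + j0)%N.
have size_pq : (size (p * q)).-1 = ((size p).-1 + (size q).-1)%N.
  have sp : (0 < size p)%N by rewrite size_poly_gt0 monic_neq0.
  have sq : (0 < size q)%N by rewrite size_poly_gt0 monic_neq0.
  by rewrite size_monicM ?monic_neq0 //; lia.
rewrite leNgt; apply/negP => ltW.
have lead_ij : P (p`_i0 * q`_j0) = W + W' + mu *+ (i0 + j0).
  by rewrite ordM // Pi0 Pj0 mulrnDr addrACA.
have i0_lt : (i0 < (i0 + j0).+1)%N by rewrite ltnS leq_addr.
apply: (@ord_ge_lead _ _ _ P _ (p`_i0 * q`_j0)
  (\sum_(l < (i0 + j0).+1 | l != Ordinal i0_lt) p`_l * q`_(i0 + j0 - l)%N) _ lead_ij).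
- by rewrite mulf_neq0.
- apply: ord_ge_sum => l ne_l.
  have [lt_l|gt_l|eq_l] := ltngtP l i0.
  + apply: (@ord_geW _ _ _ P ((W + mu *+ l + 1) + (W' + mu *+ (i0 + j0 - l)))).
      rewrite -{1}(subnKC (_ : l <= i0 + j0)%N) ?mulrnDr; last by rewrite -ltnS.
      by rewrite !addrA; lia.
    by apply: ord_geM; [apply: gtW | apply: geW'].
  + apply: (@ord_geW _ _ _ P ((W + mu *+ l) + (W' + mu *+ (i0 + j0 - l) + 1))).
      rewrite -{1}(subnKC (_ : l <= i0 + j0)%N) ?mulrnDr; last by rewrite -ltnS.
      by rewrite !addrA; lia.
    apply: ord_geM; [apply: geW | apply: gtW'].
    by have := ltn_ord l; lia.
  + by case/eqP: ne_l; apply: val_inj.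
- have -> : p`_i0 * q`_j0 + \sum_(l < (i0 + j0).+1 | l != Ordinal i0_lt)
      p`_l * q`_(i0 + j0 - l)%N = (p * q)`_(i0 + j0)%N.
    by rewrite coefM [RHS](bigD1 (Ordinal i0_lt)) //= addKn.
  apply: ord_geW ge_pq; rewrite size_pq mulrzBr -!pmulrn mulrnDr.
  lia.
Qed.

End GaussLemma.
(** * Factors of polynomials *)

Section PolynomialFactors.
Variable F : fieldType.
Implicit Types p q r : {poly F}.

Lemma monic_irreducible_factor q : (1 < size q)%N ->
  exists r, [/\ r \is monic, irreducible_poly r & r %| q].
Proof.
have [n len] := ubnP (size q); elim: n => // n IHn in q len *.
move=> q_gt1; have [q_irr|] := pselect (irreducible_poly q).
  have lc0 : (lead_coef q)^-1 != 0.
    by rewrite invr_eq0 lead_coef_eq0 -size_poly_gt0 ltnW.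
  exists ((lead_coef q)^-1 *: q); split.
  - by rewrite monicE lead_coefZ mulVf // -invr_eq0.
  - split=> [|d d1]; first by rewrite size_scale.
    by rewrite dvdpZr // (eqp_rtrans (eqp_scale _ lc0)); apply: q_irr.2.
  - by rewrite dvdpZl.
move=> /not_andP[//|] /existsNP[d /not_implyP[d1 /not_implyP[dq nqd]]].
have q0 : q != 0 by rewrite -size_poly_gt0 ltnW.
have d_lt : (size d < size q)%N.
  rewrite ltn_neqAle dvdp_leq // andbT; apply: contra_notN nqd => sdq.
  by rewrite -dvdp_size_eqp.
have d_gt1 : (1 < size d)%N.
  rewrite ltn_neqAle eq_sym d1 size_poly_gt0.
  by apply: contraTneq dq => ->; rewrite dvd0p.
have [|r [r_monic r_irr rd]] := IHn d _ d_gt1; first exact: leq_trans d_lt _.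
by exists r; split=> //; apply: dvdp_trans dq.
Qed.

Lemma irreducible_dvd_monic p q : irreducible_poly p -> p \is monic ->
  q \is monic -> q %| p -> (1 < size q)%N -> q = p.
Proof.
move=> p_irr p_monic q_monic qp q_gt1; apply/eqP.
by rewrite -eqp_monic //; apply: p_irr.2 => //; rewrite gtn_eqF.
Qed.

Lemma irreducible_dvdM r p q : irreducible_poly r ->
  (r %| p * q) = (r %| p) || (r %| q).
Proof.
move=> r_irr; have [rp|] := boolP (r %| p); first by rewrite dvdp_mulr.
by rewrite -irreducible_poly_coprime // => /Gauss_dvdpr->.
Qed.

Lemma irreducible_dvd_prod r (I : Type) (s : seq I) (P : pred I) (G : I -> {poly F}) :
  irreducible_poly r -> r %| \prod_(i <- s | P i) G i ->
  exists2 i, P i & r %| G i.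
Proof.
move=> r_irr; elim/big_rec: _ => [|i p Pi IHp].
  by rewrite dvdp1 gtn_eqF //; case: r_irr.
by rewrite irreducible_dvdM // => /orP[rGi|/IHp//]; exists i.
Qed.

Lemma irreducible_dvdX r p n : irreducible_poly r -> r %| p ^+ n -> r %| p.
Proof.
move=> r_irr; elim: n => [|n IHn].
  by rewrite expr0 dvdp1 gtn_eqF //; case: r_irr.
by rewrite exprS irreducible_dvdM // => /orP[|/IHn].
Qed.

(* The gcd normalized to be monic, so that it commutes with field morphisms. *)
Definition mgcd p q := (lead_coef (gcdp p q))^-1 *: gcdp p q.

Lemma mgcd_eqp p q : p != 0 -> mgcd p q %= gcdp p q.
Proof.
by move=> p0; rewrite eqp_scale // invr_eq0 lead_coef_eq0 gcdp_eq0 negb_and p0.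
Qed.

Lemma mgcd_monic p q : p != 0 -> mgcd p q \is monic.
Proof.
by move=> p0; rewrite monicE lead_coefZ mulVf // lead_coef_eq0 gcdp_eq0 negb_and p0.
Qed.

Lemma dvdp_mul_gcd p q g : p %| q * g -> p %| q * gcdp p g.
Proof.
by rewrite (eqp_dvdr _ (mulp_gcdr _ _ _)) dvdp_gcd dvdp_mulIr => ->.
Qed.

(** That p divides the product of the gcds follows by replacing each g_i by gcd(p, g_i) in turn; the
    converse divisibility rests on the coprimality. *)
Lemma prod_mgcd p (I : eqType) (s : seq I) (g : I -> {poly F}) : p \is monic ->
    uniq s -> {in s &, forall i j, i != j -> coprimep (g i) (g j)} ->
  p %| \prod_(i <- s) g i -> \prod_(i <- s) mgcd p (g i) = p.
Proof.
move=> p_monic s_uniq g_cop p_s; have p0 := monic_neq0 p_monic.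
apply/eqP; rewrite -eqp_monic //; last first.
  by apply: monic_prod => i _; apply: mgcd_monic.
apply/andP; split; last first.
  suff gcd_s q : p %| q * \prod_(i <- s) g i -> p %| q * \prod_(i <- s) mgcd p (g i).
    by rewrite -[X in _ %| X]mul1r gcd_s // mul1r.
  elim: s q {s_uniq g_cop p_s} => [|i s IHs] q; first by rewrite !big_nil.
  rewrite !big_cons !mulrA => p_gs; apply: IHs; move: p_gs.
  rewrite mulrAC => /dvdp_mul_gcd.
  by rewrite mulrAC -!mulrA !(eqp_dvdr _ (eqp_mull _ (eqp_mulr _ (mgcd_eqp _ p0)))).
elim: s s_uniq g_cop {p_s} => [|i s IHs] /=; first by rewrite big_nil dvd1p.
move=> /andP[i_s s_uniq] g_cop; rewrite big_cons Gauss_dvdp.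
  rewrite (eqp_dvdl _ (mgcd_eqp _ p0)) dvdp_gcdl IHs //.
  by move=> j l js ls; apply: g_cop; rewrite inE ?js ?ls orbT.
rewrite big_seq; elim/big_ind: _ => [|q q' cq cq'|j js].
- exact: coprimep1.
- by rewrite coprimepMr cq cq'.
rewrite (eqp_coprimepl _ (mgcd_eqp _ p0)) (eqp_coprimepr _ (mgcd_eqp _ p0)).
have: coprimep (g i) (g j).
  by apply: g_cop; rewrite ?inE ?eqxx ?js ?orbT //; apply: contraNneq i_s => ->.
move/(coprimep_dvdr (dvdp_gcdr p (g i))).
exact: coprimep_dvdl (dvdp_gcdr p (g j)).
Qed.

Lemma multiplicityP p s : (1 < size p)%N -> s != 0 ->
  p ^+ multiplicity p s %| s /\ ~~ (p ^+ (multiplicity p s).+1 %| s).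
Proof.
move=> p_gt1 s0; rewrite /multiplicity; split.
  elim/big_ind: _ => [|i j pi pj|//]; first by rewrite dvd1p.
  by rewrite /maxn; case: ifP.
set m := \max_(_ < _ | _) _; apply/negP => pm.
(* The maximum runs only over exponents below [size s]; a degree count shows that m + 1 is among
   them. *)
have ltm : (m.+1 < size s)%N.
  apply: leq_trans (dvdp_leq s0 pm); elim: (m.+1) => [|i IHi].
    by rewrite expr0 size_poly1.
  have p0 : p != 0 by rewrite -size_poly_gt0 ltnW.
  rewrite exprS size_mul ?expf_neq0 //.
  by move: (size p) (size (p ^+ i)) p_gt1 IHi => a b; lia.
have := @leq_bigmax_cond _ (fun i : 'I_(size s) => p ^+ i %| s)
  (fun i => i : nat) (Ordinal ltm) pm.
by rewrite ltnn.
Qed.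

Lemma multiplicity_uniq p s n t : irreducible_poly p -> s != 0 ->
  s = p ^+ n * t -> ~~ (p %| t) -> multiplicity p s = n.
Proof.
move=> p_irr s0 Ds npt; have p_gt1 : (1 < size p)%N by case: p_irr.
have p0 : p != 0 by rewrite -size_poly_gt0 ltnW.
have [pm npm] := multiplicityP p_gt1 s0; apply/eqP; rewrite eqn_leq.
apply/andP; split; rewrite leqNgt; apply/negP => lt_nm.
  case/negP: npt; have: p ^+ n.+1 %| s by apply: dvdp_trans pm; apply: dvdp_exp2l.
  by rewrite Ds exprSr dvdp_mul2l ?expf_neq0.
case/negP: npm; rewrite [X in _ %| X]Ds; apply: dvdp_mulr.
exact: (dvdp_exp2l _ lt_nm).
Qed.

Lemma monic_dvd_exp p t n : irreducible_poly p -> p \is monic -> t \is monic ->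
  t %| p ^+ n -> exists j, t = p ^+ j.
Proof.
move=> p_irr p_monic; have p0 := monic_neq0 p_monic.
elim: n t => [|n IHn] t t_monic.
  rewrite expr0 dvdp1 => t1; exists 0%N; apply/eqP.
  by rewrite expr0 -eqp_monic ?monic1 // -size_poly_eq1.
have [/dvdpP[t' Dt]|npt] := boolP (p %| t).
  rewrite Dt exprSr dvdp_mul2r // => /IHn[|j ->]; last by exists j.+1; rewrite exprSr.
  by rewrite -(monicMr _ p_monic) -Dt.
rewrite exprS Gauss_dvdpr; first exact: IHn.
by rewrite coprimep_sym irreducible_poly_coprime.
Qed.

(** Meant for the property of being a norm, which may hold for the exact power of p in s and fail
    for p. *)
Lemma prime_power_ind (N : {poly F} -> Prop) : N 1 ->
    (forall s t, N s -> N t -> N (s * t)) ->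
  forall s, s \is monic ->
    (forall p, irreducible_poly p -> p \is monic -> p %| s ->
       N (p ^+ multiplicity p s)) -> N s.
Proof.
move=> N1 NM s; have [n len] := ubnP (size s).
elim: n => // n IHn in s len * => s_monic Ns.
have s0 := monic_neq0 s_monic.
have [s_gt1|] := ltnP 1 (size s); last first.
  move=> s_le1; suff -> : s = 1 by [].
  rewrite (size1_polyC s_le1); congr _%:P; move: (monicP s_monic).
  by rewrite {1}(size1_polyC s_le1) lead_coefC.
have [p [p_monic p_irr ps]] := monic_irreducible_factor s_gt1.
have p_gt1 : (1 < size p)%N by case: p_irr.
have p0 := monic_neq0 p_monic.
have [pm npm] := multiplicityP p_gt1 s0; have Np := Ns p p_irr p_monic ps.
set m := multiplicity p s in pm npm Np.
have [t Ds] : exists t, s = p ^+ m * t.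
  by exists (s %/ p ^+ m); rewrite mulrC divpK.
have t_monic : t \is monic by rewrite -(monicMl _ (monic_exp m p_monic)) -Ds.
have m_gt0 : (0 < m)%N by rewrite lt0n; apply: contraNneq npm => ->; rewrite expr1.
have npt : ~~ (p %| t).
  by apply: contra npm => pt; rewrite Ds exprSr dvdp_mul2l ?expf_neq0.
rewrite Ds; apply: NM => //; apply: IHn => // [|q q_irr q_monic qt].
  apply: leq_trans (_ : size t < size s)%N len.
  rewrite Ds size_monicM ?monic_exp ?monic_neq0 //.
  have: (1 < size (p ^+ m))%N.
    by apply: leq_trans p_gt1 (dvdp_leq _ _); rewrite ?expf_neq0 ?dvdp_exp.
  have: (0 < size t)%N by rewrite size_poly_gt0 monic_neq0.
  by move: (size _) (size _) => a b; lia.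
have neq_qp : q != p by apply: contraNneq npt => <-.
have ncop : coprimep q (p ^+ m).
  apply: coprimep_expr; rewrite irreducible_poly_coprime //.
  apply: contra neq_qp => qp; apply/eqP/irreducible_dvd_monic => //.
  by case: q_irr.
have q_gt1 : (1 < size q)%N by case: q_irr.
have [qm nqm] := multiplicityP q_gt1 (monic_neq0 t_monic).
suff <- : multiplicity q s = multiplicity q t.
  by apply: Ns => //; rewrite Ds dvdp_mull.
have [u Dt] : exists u, t = q ^+ multiplicity q t * u.
  by exists (t %/ q ^+ multiplicity q t); rewrite mulrC divpK.
have q0 : q != 0 by rewrite monic_neq0.
apply: (@multiplicity_uniq q s _ (p ^+ m * u)) => //.
  by rewrite mulrCA -Dt.
rewrite (Gauss_dvdpr _ ncop); apply: contra nqm => qu.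
by rewrite {2}Dt exprSr dvdp_mul2l ?expf_neq0.
Qed.

Lemma monic_split q : q \is monic -> (1 < size q)%N ->
  exists q', (size q' <= (size q).-2)%N /\
    q = 'X^((size q).-1) + q`_((size q).-2) *: 'X^((size q).-2) + q'.
Proof.
move=> q_monic q_gt1; exists (\poly_(i < (size q).-2) q`_i).
split; first exact: size_poly.
apply/polyP => i; rewrite !coefD coefZ !coefXn coef_poly.
have q1 : q`_(size q).-1 = 1 by rewrite -lead_coefE (monicP q_monic).
have [lti|gti|->] := ltngtP i (size q).-2.
- by rewrite ltn_eqF ?mulr0 ?add0r //; lia.
- have [lti'|gti'|->] := ltngtP i (size q).-1; [lia| |].
    by rewrite mulr0 !addr0 nth_default //; move: gti'; case: (size q).
  by rewrite q1 mulr0 !addr0.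
- by rewrite ltn_eqF ?mulr1 ?add0r ?addr0 //; lia.
Qed.

(** Up to sign these coefficients are sums of roots. Sizes above 1 keep the truncated index [.-2]
    away from the leading coefficient. *)
Lemma subleadM p q : p \is monic -> q \is monic -> (1 < size p)%N -> (1 < size q)%N ->
  (p * q)`_(size (p * q)).-2 = p`_(size p).-2 + q`_(size q).-2.
Proof.
move=> p_monic q_monic p_gt1 q_gt1.
rewrite size_monicM ?monic_neq0 //.
have size_pq : ((size p + size q).-1.-2 = ((size p).-2 + (size q).-2).+1)%N.
  by move: (size p) (size q) p_gt1 q_gt1 => x y; lia.
rewrite size_pq {size_pq}.
have [p' [szp' Dp]] := monic_split p_monic p_gt1.
have [q' [szq' Dq]] := monic_split q_monic q_gt1.
set a := p`_(size p).-2 in Dp *; set b := q`_(size q).-2 in Dq *.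
move: (size p) (size q) p_gt1 q_gt1 szp' szq' Dp Dq.
move=> [|[|m]] // [|[|n]] //= _ _ szp' szq' Dp Dq; rewrite Dp Dq.
have -> : ('X^(m.+1) + a *: 'X^m + p') * ('X^(n.+1) + b *: 'X^n + q') =
   'X^((m + n).+2) + (a + b) *: 'X^((m + n).+1)
   + ((a * b) *: 'X^(m + n) + p' * 'X^(n.+1) + b *: (p' * 'X^n)
      + 'X^(m.+1) * q' + a *: ('X^m * q') + p' * q').
  rewrite -!mul_polyC !rmorphD !rmorphM /= !exprS !exprD; ring.
rewrite coefD coefD coefZ !coefXn eqxx mulr1 ltn_eqF // add0r.
rewrite [X in _ + X]nth_default ?addr0 //.
have szX l (r : {poly F}) : size (r * 'X^l) = if r == 0 then 0%N else (size r + l)%N.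
  by case: eqVneq => [->|r0]; rewrite ?mul0r ?size_poly0 // size_mulXn // addnC.
apply: leq_trans (_ : _ <= (m + n).+1)%N _ => //.
rewrite (leq_trans (size_polyD _ _)) // geq_max; apply/andP; split; last first.
  have [->|p'0] := eqVneq p' 0; first by rewrite mul0r size_poly0.
  have [->|q'0] := eqVneq q' 0; first by rewrite mulr0 size_poly0.
  by rewrite size_mul //; move: (size _) (size _) szp' szq' => x y; lia.
rewrite (leq_trans (size_polyD _ _)) // geq_max; apply/andP; split; last first.
  apply: leq_trans (size_scale_leq _ _) _; rewrite mulrC szX; case: ifP => // _.
  by move: (size _) szq' => y; lia.
rewrite (leq_trans (size_polyD _ _)) // geq_max; apply/andP; split; last first.
  rewrite mulrC szX; case: ifP => // _.
  by move: (size _) szq' => y; lia.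
rewrite (leq_trans (size_polyD _ _)) // geq_max; apply/andP; split; last first.
  apply: leq_trans (size_scale_leq _ _) _; rewrite szX; case: ifP => // _.
  by move: (size _) szp' => y; lia.
rewrite (leq_trans (size_polyD _ _)) // geq_max; apply/andP; split; last first.
  rewrite szX; case: ifP => // _.
  by move: (size _) szp' => y; lia.
by apply: leq_trans (size_scale_leq _ _) _; rewrite size_polyXn.
Qed.

End PolynomialFactors.
(* Bezout's identity turns a [d]-th root of [h ^ m] into a root of [h] of
   exponent [d / gcd(d, m)], up to roots of unity, which are present in [K]. *)
Lemma root_of_root_exp (K L : fieldType) (phi : {rmorphism K -> L}) (d m : nat)
    (zeta h : K) (v : L) : d.-primitive_root zeta -> h != 0 -> (0 < m)%N ->
  v ^+ d = phi (h ^+ m) -> exists w : L, w ^+ (d %/ gcdn d m) = phi h.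
Proof.
move=> prim_zeta h0 m_gt0 vd; have d_gt0 := prim_order_gt0 prim_zeta.
set e := gcdn d m; have e_gt0 : (0 < e)%N by rewrite gcdn_gt0 d_gt0.
have [d' Dd] : exists d', d = (d' * e)%N by exists (d %/ e)%N; rewrite divnK ?dvdn_gcdl.
have [m' Dm] : exists m', m = (m' * e)%N by exists (m %/ e)%N; rewrite divnK ?dvdn_gcdr.
have co_dm : gcdn m' d' = 1%N.
  apply/eqP; rewrite -(eqn_pmul2r e_gt0) mul1n muln_gcdl -Dd -Dm gcdnC.
  exact: eqxx.
rewrite {1}Dd mulnK //.
have m'_gt0 : (0 < m')%N by move: m_gt0; rewrite Dm muln_gt0 => /andP[].
have h0' : phi h != 0 by rewrite fmorph_eq0.
pose omega := v ^+ d' / phi h ^+ m'.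
have omega_e : omega ^+ e = 1.
  by rewrite expr_div_n -!exprM -Dd -Dm vd rmorphXn divff // expf_neq0.
have prim_e : e.-primitive_root (phi zeta ^+ d').
  have := dvdn_prim_root prim_zeta (dvdn_gcdl d m); rewrite -/e [X in (X %/ e)%N]Dd mulnK //.
  by rewrite -rmorphXn fmorph_primitive_root.
have [j Dj] := prim_rootP prim_e omega_e.
have [a b Dab _] := egcdnP d' m'_gt0; rewrite co_dm addn1 in Dab.
have zeta0 : phi zeta != 0.
  rewrite fmorph_eq0; apply: contra_eq_neq (prim_expr_order prim_zeta) => ->.
  by rewrite expr0n gtn_eqF //= eq_sym oner_neq0.
(* From a m' = b d' + 1, the d'-th power of v^a / h^b is h up to the factor omega^a, and the power
   of zeta removes this factor. *)
exists (v ^+ a / phi h ^+ b / phi zeta ^+ (j * a)).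
have vE : v ^+ d' = omega * phi h ^+ m' by rewrite divfK // expf_neq0.
rewrite !expr_div_n -!exprM [(a * d')%N]mulnC exprM vE exprMn -exprM.
rewrite [(m' * a)%N]mulnC Dab exprS [(j * a * d')%N]mulnC mulnA !exprM -Dj.
have omega0 : omega != 0.
  by apply: contra_eq_neq (omega_e) => ->; rewrite expr0n gtn_eqF //= eq_sym oner_neq0.
rewrite -!exprM; field; rewrite !expf_neq0 //.
Qed.

(** * Norms in Kummer extensions *)

Section KummerExtensions.
Variables (K : fieldType) (F : splittingFieldType K).

Local Notation Gal := ('Gal({:F} / 1%AS))%g.

Definition gal_norm (q : {poly F}) : {poly F} := \prod_(s in Gal) map_poly s q.

Lemma gal_alg (s : gal_of {:F}) (c : K) : s c%:A = c%:A.
Proof. by rewrite linearZ /= rmorph1. Qed.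

Lemma map_gal_alg (s : gal_of {:F}) (p : {poly K}) :
  map_poly s (map_poly (in_alg F) p) = map_poly (in_alg F) p.
Proof.
rewrite -map_poly_comp /=; apply: eq_map_poly => c /=; exact: gal_alg.
Qed.

Lemma gal_norm1 : gal_norm 1 = 1.
Proof. by rewrite /gal_norm big1 // => s _; rewrite rmorph1. Qed.

Lemma gal_normM q r : gal_norm (q * r) = gal_norm q * gal_norm r.
Proof. by rewrite -big_split; apply: eq_bigr => s _; rewrite rmorphM. Qed.

Lemma gal_normX q n : gal_norm (q ^+ n) = gal_norm q ^+ n.
Proof. by rewrite -prodrXl; apply: eq_bigr => s _; rewrite rmorphXn. Qed.

Lemma map_poly_galM (s t : gal_of {:F}) (q : {poly F}) :
  map_poly (s * t)%g q = map_poly t (map_poly s q).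
Proof.
by rewrite -map_poly_comp; apply: eq_map_poly => x /=; rewrite galM ?memvf.
Qed.

Lemma map_poly_gal1 (q : {poly F}) : map_poly (1%g : gal_of {:F}) q = q.
Proof. by rewrite map_poly_id // => x _; rewrite gal_id. Qed.

Lemma gal_norm_gal (t : gal_of {:F}) q : t \in Gal ->
  gal_norm (map_poly t q) = gal_norm q.
Proof.
move=> tG; rewrite /gal_norm [RHS](reindex_inj (mulgI t)) /=.
apply: eq_big => [s|s _]; first by rewrite groupMl.
by rewrite map_poly_galM.
Qed.

Lemma map_gal_norm (t : gal_of {:F}) q : t \in Gal ->
  map_poly t (gal_norm q) = gal_norm q.
Proof.
move=> tG; rewrite /gal_norm rmorph_prod [RHS](reindex_inj (mulIg t)) /=.
apply: eq_big => [s|s _]; first by rewrite groupMr.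
by rewrite map_poly_galM.
Qed.

Lemma gal_norm_monic q : q \is monic -> gal_norm q \is monic.
Proof. by move=> q_monic; apply: monic_prod => s _; rewrite monic_map. Qed.

Lemma gal_norm_alg (p : {poly K}) :
  gal_norm (map_poly (in_alg F) p) = map_poly (in_alg F) (p ^+ #|Gal|).
Proof.
rewrite /gal_norm; under eq_bigr do rewrite map_gal_alg.
by rewrite prodr_const rmorphXn.
Qed.

Lemma prod_periodic (R : comNzRingType) (f : nat -> R) n e :
  (forall i, f (i + n)%N = f i) ->
  \prod_(0 <= i < e * n) f i = (\prod_(0 <= i < n) f i) ^+ e.
Proof.
move=> f_per; elim: e => [|e IHe]; first by rewrite mul0n big_geq.
rewrite mulSn (@big_cat_nat _ _ _ n) ?leq_addr //= exprS; congr (_ * _).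
rewrite -IHe -[X in index_iota X]add0n big_addn addKn.
by apply: eq_bigr.
Qed.

Hypothesis galF : galois 1 {:F}.

Lemma gal_fixed_poly (q : {poly F}) : (forall s, s \in Gal -> map_poly s q = q) ->
  exists p, q = map_poly (in_alg F) p.
Proof.
move=> q_fix; apply/polyOver1P/polyOverP => i.
rewrite -(galois_fixedField galF); apply/fixedFieldP; rewrite ?memvf // => s sG.
by rewrite -[in RHS](q_fix s sG) coef_map.
Qed.

Variables (d : nat) (zeta h : K) (u : F).
Hypotheses (prim_zeta : d.-primitive_root zeta) (u0 : u != 0).
Hypotheses (card_Gal : #|Gal| = d) (uE : u ^+ d = h%:A).
Hypothesis u_gen : forall s : gal_of {:F}, s \in Gal -> s u = u -> s = 1%g.

Let d_gt0 : (0 < d)%N. Proof. exact: prim_order_gt0 prim_zeta. Qed.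

Let prim_zetaF : d.-primitive_root (in_alg F zeta).
Proof. by rewrite fmorph_primitive_root. Qed.

(** The Kummer character, written additively; [kummer_expP] shows that the default value is never
    taken. *)
Definition kummer_exp (s : gal_of {:F}) : 'I_d :=
  odflt (Ordinal d_gt0) [pick i : 'I_d | s u == (zeta ^+ i)%:A * u].

Lemma kummer_expP (s : gal_of {:F}) : s u = (zeta ^+ kummer_exp s)%:A * u.
Proof.
rewrite /kummer_exp; case: pickP => [i /eqP//|no_i] /=.
have [|i sui] := prim_rootP prim_zetaF (_ : (s u / u) ^+ d = 1).
  by rewrite expr_div_n -rmorphXn /= uE gal_alg divff // -uE expf_neq0.
move/negP: (no_i i); case; apply/eqP; rewrite -[s u](divfK u0) sui.
by rewrite -rmorphXn.
Qed.

Lemma kummer_exp_inj : {in Gal &, injective kummer_exp}.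
Proof.
move=> s t sG tG st; have := kummer_expP s; rewrite st -kummer_expP => su.
apply: (mulIg t^-1%g); rewrite mulgV; apply: u_gen; first by rewrite groupM ?groupV.
by rewrite galM ?memvf // su -galM ?memvf // mulgV gal_id.
Qed.

Lemma kummer_exp_surj i : exists2 s, s \in Gal & kummer_exp s = i.
Proof.
have: i \in kummer_exp @: Gal.
  suff -> : kummer_exp @: Gal = [set: 'I_d] by rewrite inE.
  apply/eqP; rewrite eqEcard subsetT cardsT card_ord card_in_imset //=.
    by rewrite card_Gal.
  exact: kummer_exp_inj.
by case/imsetP => s sG ->; exists s.
Qed.

Lemma prod_kummer_exp (f : nat -> {poly F}) :
  \prod_(s in Gal) f (kummer_exp s) = \prod_(0 <= i < d) f i.
Proof.
rewrite big_mkord -(big_imset (fun i : 'I_d => f i) kummer_exp_inj) /=.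
apply: eq_bigl => i; apply/imsetP; have [s sG <-] := kummer_exp_surj i.
by exists s.
Qed.

Lemma factor_kummer (T : {poly F}) (n : nat) (z a : F) : n.-primitive_root z ->
  a != 0 -> \prod_(0 <= i < n) (T - (z ^+ i * a)%:P) = T ^+ n - (a ^+ n)%:P.
Proof.
move=> z_prim a0.
have /(congr1 (fun q => q \Po (a^-1 *: T))) := factor_Xn_sub_1 z_prim.
rewrite rmorph_prod rmorphB rmorphXn rmorph1 /= comp_polyX => E.
have -> : T ^+ n - (a ^+ n)%:P = (a ^+ n) *: ((a^-1 *: T) ^+ n - 1).
  rewrite scalerBr exprZn scalerA -exprMn mulfV // expr1n scale1r.
  by rewrite alg_polyC.
rewrite -E -[X in a ^+ X]subn0 -prodr_const_nat -scaler_prod.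
apply: eq_bigr => i _; rewrite rmorphB /= comp_polyX comp_polyC scalerBr scalerA.
by rewrite mulfV // scale1r -mul_polyC -polyCM mulrC.
Qed.

(** An automorphism u -> zeta^i u carries gcd(p, T - u^e) to gcd(p, T - z^i u^e) with z = zeta^e of
    order d/e. As i runs below d, each gcd occurs e times; they are coprime because their second
    arguments differ by non-zero constants. *)
Lemma kummer_factor_norm (p T : {poly K}) (e : nat) : p \is monic ->
    (e %| d)%N -> p %| T ^+ (d %/ e) - h%:P ->
  exists2 r : {poly F}, r \is monic &
    gal_norm r = map_poly (in_alg F) (p ^+ e).
Proof.
move=> p_monic e_d pT; set d' := (d %/ e)%N in pT.
have d'_d : (d' %| d)%N by apply: dvdn_div.
have dE : (d %/ d' = e)%N by rewrite /d' divnA // mulKn.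
have z_prim := dvdn_prim_root prim_zetaF d'_d; rewrite dE in z_prim.
set z := _ ^+ e in z_prim.
pose TF := map_poly (in_alg F) T; pose pF := map_poly (in_alg F) p.
pose g i := TF - (z ^+ i * u ^+ e)%:P.
have ue0 : u ^+ e != 0 by rewrite expf_neq0.
have pF_monic : pF \is monic by rewrite monic_map.
have pg : pF %| \prod_(0 <= i < d') g i.
  rewrite factor_kummer // -exprM [(e * d')%N]mulnC divnK // uE.
  rewrite -[h%:A]/(in_alg F h) -map_polyC -rmorphXn -rmorphB /=.
  by rewrite dvdp_map.
exists (mgcd pF (g 0%N)); first by rewrite mgcd_monic ?monic_neq0.
have map_r s : s \in Gal -> map_poly s (mgcd pF (g 0%N)) = mgcd pF (g (kummer_exp s)).
  move=> sG; rewrite /mgcd map_polyZ /= fmorphV -lead_coef_map gcdp_map.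
  rewrite map_gal_alg /g rmorphB /= map_gal_alg map_polyC /= expr0 mul1r.
  rewrite rmorphXn /= kummer_expP exprMn -[_%:A]/(in_alg F _) rmorphXn /=.
  by rewrite -!exprM mulnC.
rewrite /gal_norm (eq_bigr _ map_r) (prod_kummer_exp (fun i => mgcd pF (g i))).
rewrite -(divnK e_d) mulnC prod_periodic => [|i]; last first.
  by rewrite /g exprD (prim_expr_order z_prim) mulr1.
rewrite rmorphXn; congr (_ ^+ _); apply: prod_mgcd pg => //.
  exact: iota_uniq.
move=> i j; rewrite !mem_index_iota /= => lti ltj ne_ij.
apply/coprimepP => q qi qj.
have: q %| ((z ^+ j - z ^+ i) * u ^+ e)%:P.
  have -> : ((z ^+ j - z ^+ i) * u ^+ e)%:P = g i - g j.
    by rewrite /g mulrBl polyCB; ring.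
  exact: dvdp_sub.
set c := _ * _ => qc; have c0 : c != 0.
  rewrite mulf_neq0 // subr_eq0; apply: contra ne_ij.
  by rewrite (eq_prim_root_expr z_prim) eq_sym !modn_small.
rewrite -size_poly_eq1 -dvdp1 (dvdp_trans qc) //.
have -> : 1 = c^-1%:P * c%:P by rewrite -polyCM mulVf.
exact: dvdp_mulIr.
Qed.


Lemma map_gal_irreducible (s : gal_of {:F}) (r : {poly F}) :
  irreducible_poly r -> irreducible_poly (map_poly s r).
Proof.
move=> [r_gt1 r_irr]; split=> [|q q1 qr]; first by rewrite size_map_poly.
have qE : map_poly s (map_poly s^-1%g q) = q.
  by rewrite -map_poly_galM mulVg map_poly_gal1.
rewrite -qE eqp_map; apply: r_irr; first by rewrite size_map_poly.
by rewrite -(dvdp_map s) qE.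
Qed.

Lemma kummer_expgP (s : gal_of {:F}) n :
  (s ^+ n)%g u = (zeta ^+ (kummer_exp s * n))%:A * u.
Proof.
elim: n => [|n IHn]; first by rewrite expg0 gal_id muln0 expr0 scale1r mul1r.
rewrite expgS galM ?memvf // kummer_expP rmorphM /= gal_alg IHn.
by rewrite !mulr_algl scalerA -exprD -mulnS.
Qed.

Lemma sum_gal_fixed (q : {poly F}) :
  exists p, \sum_(s in Gal) map_poly s q = map_poly (in_alg F) p.
Proof.
apply: gal_fixed_poly => t tG; rewrite rmorph_sum [RHS](reindex_inj (mulIg t)) /=.
apply: eq_big => [s|s _]; first by rewrite groupMr.
by rewrite map_poly_galM.
Qed.

(* The distinct conjugates of [r] are pairwise coprime and each occurs [e] times in
   the norm, [e] being the order of the stabilizer of [r]; the powers [s u ^+ e] depend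
   only on the conjugate [s r], so there is [T] over [K] congruent to [s u ^+ e]
   modulo each [s r], up to the factor [e]. *)
Lemma irreducible_factor_norm (p : {poly K}) (r : {poly F}) :
    d%:R != 0 :> K ->
    irreducible_poly p -> p \is monic -> separable_poly p ->
    r \is monic -> irreducible_poly r -> r %| map_poly (in_alg F) p ->
  exists e : nat, [/\ (e %| d)%N, gal_norm r = map_poly (in_alg F) (p ^+ e) &
    exists T : {poly K}, p %| T ^+ (d %/ e) - h%:P].
Proof.
move=> dK0 p_irr p_monic p_sep r_monic r_irr r_p.
set pF := map_poly (in_alg F) p in r_p *.
have r_gt1 : (1 < size r)%N by case: r_irr.
have r0 := monic_neq0 r_monic.
have pF_monic : pF \is monic by rewrite monic_map.
have pF_sep : separable_poly pF by rewrite separable_map.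
pose S := [set s in Gal | map_poly s r == r].
have S_group : group_set S.
  apply/group_setP; split=> [|s t]; first by rewrite inE group1 map_poly_gal1 /=.
  rewrite !inE => /andP[sG /eqP sr] /andP[tG /eqP tr].
  by rewrite groupM //= map_poly_galM sr tr.
pose Sgroup := group S_group.
have S_sub : S \subset Gal by apply/subsetP => s; rewrite inE => /andP[].
pose e := #|S|.
have e_d : (e %| d)%N.
  by rewrite -card_Gal; apply: (cardSg (S_sub : Sgroup \subset 'Gal({:F} / 1%AS)%G)).
have e_gt0 : (0 < e)%N by apply: (cardG_gt0 Sgroup).
have eK0 : e%:R != 0 :> K.
  by apply: contraNneq dK0 => e0; rewrite -(divnK e_d) natrM e0 mulr0.
have [p1 Dp] : exists p1, pF = p1 * r by exists (pF %/ r); rewrite divpK.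
have p1_r : coprimep p1 r.
  by have /separable_polyP[+ _] := pF_sep; apply; rewrite Dp.
have S_coprime (s : gal_of {:F}) : s \in Gal -> s \notin S ->
    coprimep r (map_poly s r).
  rewrite inE => sG; rewrite sG /= => sr; rewrite irreducible_poly_coprime //.
  apply: contra sr => rsr; rewrite eq_sym; apply/eqP/irreducible_dvd_monic => //.
    exact: map_gal_irreducible.
  by rewrite monic_map.
have map_pF (s : gal_of {:F}) : pF = map_poly s p1 * map_poly s r.
  by rewrite -rmorphM -Dp /pF /= map_gal_alg.
exists e; split=> //.
  have [t Dt] : exists t, gal_norm r = map_poly (in_alg F) t.
    by apply: gal_fixed_poly => s sG; apply: map_gal_norm.
  have [j Dj] : exists j, t = p ^+ j.
    apply: (@monic_dvd_exp _ p _ d) => //.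
      by rewrite -(map_monic (in_alg F)) -Dt gal_norm_monic.
    rewrite -(dvdp_map (in_alg F)) -Dt -card_Gal -gal_norm_alg.
    by rewrite -/pF Dp gal_normM dvdp_mulIr.
  rewrite Dt Dj; congr (map_poly _ (_ ^+ _)).
  have N0 : gal_norm r != 0 by rewrite monic_neq0 ?gal_norm_monic.
  (* The factor r is counted twice in its norm: j times in p^j, by separability of p, and e times
     among its own conjugates. *)
  transitivity (multiplicity r (gal_norm r)).
    apply/esym/(@multiplicity_uniq _ r _ j (p1 ^+ j)) => //.
      by rewrite Dt Dj rmorphXn /= -/pF Dp exprMn mulrC.
    apply/negP => /(irreducible_dvdX r_irr) r_p1.
    by have := p1_r; rewrite coprimep_sym irreducible_poly_coprime // r_p1.
  apply: (@multiplicity_uniq _ r _ e (\prod_(s in Gal | s \notin S) map_poly s r)) => //.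
    rewrite /gal_norm (bigID (mem S)) /=; congr (_ * _).
    rewrite (eq_bigl (fun s => s \in S)) => [|s]; last by rewrite /= !inE andbA andbb.
    rewrite (eq_bigr (fun=> r)) ?prodr_const // => s.
    by rewrite inE => /andP[_ /eqP].
  apply/negP => /(irreducible_dvd_prod r_irr)[s /andP[sG sS]].
  have := S_coprime s sG sS; rewrite irreducible_poly_coprime //.
  by move=> /negP.
(* The product a p1 is 1 modulo r, while its conjugates by elements outside S are divisible by r.
   The trace of a p1 u^e is therefore e u^e modulo r. *)
have [[a b] /= ab1] := Bezout_eq1_coprimepP _ _ p1_r.
have [T DT] := sum_gal_fixed (a * p1 * (u ^+ e)%:P).
exists (e%:R^-1 *: T).
have T_r : r %| map_poly (in_alg F) T - (e%:R * u ^+ e)%:P.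
  have -> : (e%:R * u ^+ e)%:P = \sum_(s in Gal | s \in S) (u ^+ e)%:P.
    rewrite (eq_bigl (fun s => s \in S)) => [|s]; last by rewrite /= !inE andbA andbb.
    by rewrite sumr_const -/e mulr_natl polyCMn.
  rewrite -DT (bigID (mem S)) /= addrAC -sumrB; apply: dvdp_add.
    elim/big_ind: _ => [||s /andP[sG sS]]; [exact: dvdp0|exact: dvdp_add|].
    have sr : map_poly s r = r by move: sS; rewrite inE => /andP[_ /eqP].
    (* The order of s divides e = #|S|, so the e-th power of the root of unity s(u) / u is 1. *)
    have sue : s (u ^+ e) = u ^+ e.
      have /(congr1 (fun s : gal_of {:F} => s u)) := expg_cardG (sS : s \in Sgroup).
      rewrite kummer_expgP gal_id -/e => ze; rewrite rmorphXn /= kummer_expP exprMn.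
      rewrite exprZn expr1n -exprM.
      by rewrite (mulIf u0 (etrans ze (esym (mul1r u)))) mul1r.
    rewrite !rmorphM /= map_polyC /= sue -[X in _ - X]mul1r -mulrBl dvdp_mulr //.
    rewrite -[X in _ - X](rmorph1 (map_poly s)) -ab1 rmorphD /= opprD addrA.
    rewrite -rmorphM subrr add0r dvdpNr rmorphM /= sr.
    exact: dvdp_mulIr.
  elim/big_ind: _ => [||s /andP[sG sS]]; [exact: dvdp0|exact: dvdp_add|].
  rewrite !rmorphM /= dvdp_mulr // dvdp_mull //.
  by rewrite -(Gauss_dvdpl _ (S_coprime s sG sS)) -map_pF.
have rT : r %| map_poly (in_alg F) ((e%:R^-1 *: T) ^+ (d %/ e) - h%:P).
  rewrite rmorphB rmorphXn /= map_polyZ map_polyC /= -uE -{2}(divnK e_d).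
  rewrite [(_ * e)%N]mulnC exprM polyC_exp subrXX dvdp_mulr //.
  have -> : (u ^+ e)%:P = (e%:R^-1)%:A *: (e%:R * u ^+ e)%:P.
    rewrite -mul_polyC -polyCM mulrA -[_%:A]/(in_alg F _) fmorphV rmorph_nat.
    rewrite mulVf ?mul1r // -(rmorph_nat (in_alg F)) fmorph_eq0 //.
  by rewrite -scalerBr dvdpZr // -[_%:A]/(in_alg F _) fmorph_eq0 invr_eq0.
(* Otherwise p would be coprime to this polynomial over K, hence over F, where r divides both. *)
apply: contraLR r_gt1; rewrite -irreducible_poly_coprime //.
rewrite -(coprimep_map (in_alg F)) -leqNgt => /coprimepP/(_ r r_p rT).
by rewrite -size_poly_eq1 => /eqP->.
Qed.

(** As long as p divides the norm of q, some conjugate of r divides q; removing it lowers the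
    exponent of p by exactly e. *)
Lemma gal_norm_split (p : {poly K}) (r : {poly F}) (e m : nat) (s' : {poly K}) q :
    irreducible_poly p -> p \is monic ->
    r \is monic -> irreducible_poly r -> r %| map_poly (in_alg F) p ->
    gal_norm r = map_poly (in_alg F) (p ^+ e) ->
    q \is monic -> gal_norm q = map_poly (in_alg F) (p ^+ m * s') ->
  ~~ (p %| s') -> (e %| m)%N.
Proof.
move=> p_irr p_monic r_monic r_irr r_p Nr.
have [n len] := ubnP (size q); elim: n => // n IHn in q m len *.
move=> q_monic Nq ps'; have [->//|m_gt0] := posnP m.
have r_q : r %| gal_norm q.
  rewrite Nq; apply: dvdp_trans r_p _; rewrite dvdp_map dvdp_mulr //.
  by rewrite -(prednK m_gt0) exprS dvdp_mulIl.
have [s sG rs] := irreducible_dvd_prod r_irr r_q.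
set r1 := map_poly s^-1%g r.
have r1_monic : r1 \is monic by rewrite monic_map.
have r1_q : r1 %| q.
  by rewrite -(dvdp_map s) /r1 -map_poly_galM mulVg map_poly_gal1.
have [q1 Dq] : exists q1, q = q1 * r1 by exists (q %/ r1); rewrite divpK.
have q1_monic : q1 \is monic by rewrite -(monicMr _ r1_monic) -Dq.
have [t Dt] : exists t, gal_norm q1 = map_poly (in_alg F) t.
  by apply: gal_fixed_poly => t tG; apply: map_gal_norm.
have Npq : p ^+ m * s' = t * p ^+ e.
  apply: (map_poly_inj (in_alg F)); rewrite -Nq Dq gal_normM Dt.
  by rewrite gal_norm_gal ?groupV // Nr rmorphM.
have p0 := monic_neq0 p_monic.
have [lt_me|le_em] := ltnP m e.
  case/negP: ps'; rewrite -(dvdp_mul2l _ _ (expf_neq0 m p0)) Npq -exprSr.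
  by rewrite dvdp_mull // dvdp_exp2l.
have Ds' : t = p ^+ (m - e) * s'.
  apply: (mulIf (expf_neq0 e p0)); rewrite -Npq mulrAC -exprD subnK //.
rewrite -(subnK le_em) dvdn_addl // (IHn q1) //; last by rewrite Dt Ds'.
apply: leq_trans (_ : size q1 < size q)%N len.
rewrite Dq size_monicM ?monic_neq0 //.
by rewrite -subn1 ltn_subRL [(1 + _)%N]addnC ltn_add2l size_map_poly; case: r_irr.
Qed.

End KummerExtensions.
(** * Cyclic covers and spectral polynomials *)

Section Covers.

Lemma prim_root_exists (k : closedFieldType) (d : nat) :
  d%:R != 0 :> k -> exists z : k, d.-primitive_root z.
Proof.
move=> dk0; have d_gt0 : (0 < d)%N by rewrite lt0n; apply: contraNneq dk0 => ->.
have [rs] := closed_field_poly_normal ('X^d - 1 : {poly k}).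
rewrite (monicP (monic_Xn_sub_1 _ d_gt0)) scale1r => Drs.
have rs_uniq : uniq rs by rewrite -separable_prod_XsubC -Drs separable_Xn_sub_1.
have rs_size : size rs = d.
  by apply: succn_inj; rewrite -(size_prod_XsubC rs id) -Drs size_Xn_sub_1.
have: has d.-primitive_root rs.
  apply: has_prim_root => //; last by rewrite rs_size.
  apply/allP => z z_rs; rewrite /root_of_unity /root Drs.
  by rewrite -/(root _ z) root_prod_XsubC.
by case/hasP => z _ z_prim; exists z.
Qed.

Lemma in_alg_finite_ext (K : fieldType) (L : fieldExtType K) :
  finite_ext (in_alg L : {rmorphism K -> L}).
Proof.
exists 'I_(\dim {:L}), (fun i : 'I__ => (vbasis {:L})`_i) => y.
exists (fun i : 'I__ => coord (vbasis {:L}) i y).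
by rewrite [LHS](coord_vbasis (memvf y)); apply: eq_bigr => i _; rewrite /= mulr_algl.
Qed.

Lemma qfpoly_finite_ext (K : fieldType) (p : {poly K}) (pI : monic_irreducible_poly p) :
  finite_ext (in_alg {poly %/ p with pI} : {rmorphism K -> {poly %/ p with pI}}).
Proof.
pose B := vbasis (fullv : {vspace {poly %/ p with pI}}).
exists 'I_(\dim (fullv : {vspace {poly %/ p with pI}})), (fun i : 'I__ => B`_i) => y.
exists (fun i : 'I__ => coord B i y).
by rewrite [LHS](coord_vbasis (memvf y)); apply: eq_bigr => i _; rewrite /= mulr_algl.
Qed.

Lemma galois_char0 (K : fieldType) (F : splittingFieldType K) :
  [pchar K] =i pred0 -> galois 1 {:F}.
Proof.
move=> charK; rewrite /galois sub1v normalFieldf andbT.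
apply/separableP => y _; apply: pcharf0_separable => q.
by rewrite (fmorph_pchar (in_alg F)).
Qed.

Lemma irreducible_separable (K : fieldType) (p : {poly K}) :
  [pchar K] =i pred0 -> irreducible_poly p -> p \is monic -> separable_poly p.
Proof.
move=> charK p_irr p_monic; have p_gt1 : (1 < size p)%N by case: p_irr.
rewrite unlock irreducible_poly_coprime //; apply/negP => p_dp.
have dp0 : p^`() != 0.
  apply/eqP => /polyP/(_ (size p).-2); rewrite coef_deriv coef0.
  have -> : (size p).-2.+1 = (size p).-1 by case: (size p) p_gt1 => [|[]].
  rewrite -lead_coefE (monicP p_monic) => /eqP.
  by have /pcharf0P-> := charK; case: (size p) p_gt1 => [|[]].
have := dvdp_leq dp0 p_dp; rewrite leqNgt => /negP[].
by apply: lt_size_deriv; apply: monic_neq0.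
Qed.

End Covers.

(** * The cyclic cover as a Kummer extension *)

Section CyclicCovers.

Lemma cyclic_subgroup_order (V : zmodType) (G : {fset V}) (g : V) (n : nat) :
    (forall x, x \in G <-> exists z : int, x = g *~ z) -> (0 < n)%N -> g *+ n = 0 ->
  [/\ (0 < #|` G|)%N, g *+ #|` G| = 0, (#|` G| %| n)%N
    & forall x, x \in G -> exists2 i, (i < #|` G|)%N & x = g *+ i].
Proof.
move=> Gg n_gt0 gn; pose A i := (0 < i)%N && (g *+ i == 0).
have exA : exists i, A i by exists n; rewrite /A n_gt0 gn eqxx.
case: (ex_minnP exA) => o /andP[o_gt0 /eqP go] o_min.
have g_mod i : g *+ i = g *+ (i %% o).
  by rewrite {1}(divn_eq i o) mulrnDr mulnC mulrnA go mul0rn add0r.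
have inG x : x \in G -> exists2 i, (i < o)%N & x = g *+ i.
  move=> /Gg[z ->]; have o0 : o%:Z != 0 by rewrite -lt0n in o_gt0 *.
  have z0 : (0 <= z %% o%:Z)%Z by apply: modz_ge0.
  exists `|(z %% o%:Z)%Z|%N; first by rewrite -ltz_nat gez0_abs // ltz_pmod.
  rewrite pmulrn gez0_abs // {1}(divz_eq z o%:Z) mulrzDr mulrC mulrzA -pmulrn go.
  by rewrite mul0rz add0r.
have g_inj i j : (i <= j)%N -> (j < o)%N -> g *+ i = g *+ j -> i = j.
  move=> le_ij lt_jo gij; apply/eqP; rewrite eqn_leq le_ij leqNgt.
  apply/negP => lt_ij; have := o_min (j - i)%N; rewrite /A subn_gt0 lt_ij /=.
  rewrite mulrnBr // gij subrr eqxx => /(_ isT); rewrite leqNgt => /negP[].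
  exact: leq_ltn_trans (leq_subr _ _) lt_jo.
have card_G : #|` G| = o.
  rewrite -[RHS](size_iota 0) -(size_map (fun i => g *+ i)).
  apply/perm_size/uniq_perm; first exact: fset_uniq.
    rewrite map_inj_in_uniq ?iota_uniq // => i j; rewrite !mem_iota !add0n /=.
    move=> lt_i lt_j gij; have [le_ij|/ltnW le_ji] := leqP i j; first exact: g_inj.
    by apply/esym/g_inj.
  move=> x; apply/idP/mapP => [/inG[i lti ->]|[i _ ->]].
    by exists i; rewrite // mem_iota.
  by apply/Gg; exists i%:Z.
rewrite card_G; split=> //; apply: contraT => r0.
have := o_min (n %% o)%N; rewrite /A lt0n r0 -g_mod gn eqxx => /(_ isT).
by rewrite leqNgt ltn_pmod.
Qed.

Variables (k : numClosedFieldType) (K : fieldType) (iota : {rmorphism k -> K}).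
Variables (Gamma : {fset Pic iota}) (F : splittingFieldType K).

(** The Kummer generator is the basis vector of the summand of g. Its powers span the lines of all
    the summands, so its d-th power is a scalar and an automorphism fixing it is trivial; the degree
    is the number of summands. *)
Lemma cover_kummer (g : Pic iota) (n : nat) :
    (forall x, x \in Gamma <-> exists z : int, x = g *~ z) ->
    (0 < n)%N -> g *+ n = 0 -> cover_of Gamma F ->
  exists (E : divisor iota) (u : F) (h : K), [/\ class E = g, u != 0, h != 0,
      u ^+ #|` Gamma| = h%:A
    & (forall P : point iota, P h = mult_at E P *+ #|` Gamma|) /\
      (#|'Gal({:F} / 1%AS)%g| = #|` Gamma| /\
       forall s : gal_of {:F}, s u = u -> s = 1%g)].
Proof.
move=> Gg n_gt0 gn [E [u [E_class u_basis _ u_mul]]].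
have [o_gt0 go _ inG] := cyclic_subgroup_order Gg n_gt0 gn.
set o := #|` Gamma| in o_gt0 go inG *.
have memG i : g *+ i \in Gamma by apply/Gg; exists i%:Z.
have g_in : g \in Gamma by rewrite -[g]mulr1n memG.
pose G1 : Gamma := FSetSub g_in.
have u_inj (x y : {ffun Gamma -> K}) :
    \sum_(L : Gamma) x L *: u L = \sum_(L : Gamma) y L *: u L -> x = y.
  move=> xy; have [x0 [_ uniq_x0]] := u_basis (\sum_(L : Gamma) x L *: u L).
  by rewrite -(uniq_x0 x) // -(uniq_x0 y).
have u_neq0 L : u L != 0.
  apply/eqP => uL.
  have /ffunP/(_ L)/eqP : [ffun L' => (L' == L)%:R : K] = [ffun=> 0].
    apply: u_inj; transitivity (0 : F).
      rewrite big1 // => L' _; rewrite ffunE.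
      by have [->|_] := eqVneq L' L; rewrite ?uL ?scaler0 ?scale0r.
    by rewrite big1 // => L' _; rewrite ffunE scale0r.
  by rewrite !ffunE eqxx oner_eq0.
(* Exponents start at 1, because 1 is not yet known to lie on the line of the trivial class. *)
have powers i (L : Gamma) : val L = g *+ i.+1 -> exists c, [/\ c != 0,
    u G1 ^+ i.+1 = c *: u L
    & forall P : point iota, P c = mult_at (E G1) P *+ i.+1 - mult_at (E L) P].
  elim: i L => [|i IHi] L DL.
    have -> : L = G1 by apply: val_inj; rewrite DL mulr1n.
    exists 1; rewrite oner_eq0 scale1r expr1; split=> // P.
    by rewrite ord1 mulr1n subrr.
  have [c [c0 Dc cE]] := IHi (FSetSub (memG i.+1)) erefl.
  have [y y0 [Dy yE]] := u_mul G1 (FSetSub (memG i.+1)) L (etrans DL (mulrS _ _)).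
  exists (c * y); rewrite mulf_neq0 //; split=> // [|P].
    by rewrite exprS Dc -scalerAr Dy scalerA.
  rewrite ordM // cE yE /mult_at coeffB coeffD mulrS; ring.
have G0_in : 0 \in Gamma by rewrite -[0](mulr0n g) memG.
pose G0 : Gamma := FSetSub G0_in.
(* The basis vector of the trivial class need not be 1, but its square is a scalar multiple of it,
   so it is itself a scalar. *)
have [y y0 [Dy yE]] := u_mul G0 G0 G0 (esym (addr0 _)).
have uG0 : u G0 = y%:A by apply: (mulIf (u_neq0 G0)); rewrite Dy mulr_algl.
have [|c [c0 Dc cE]] := powers o.-1 G0; first by rewrite prednK.
rewrite prednK // in Dc cE.
exists (E G1), (u G1), (c * y); split; rewrite ?mulf_neq0 //.
  by rewrite Dc uG0 scalerA.
split=> [P|]; first by rewrite ordM // cE yE /mult_at coeffB coeffD; ring.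
split=> [|s su].
  have galF : galois 1 {:F}.
    apply: galois_char0 => p; rewrite (fmorph_pchar iota).
    exact: pchar_num.
  rewrite -galois_dim // dimv1 divn1.
  pose X := codom_tuple u.
  have X_nth (L : Gamma) : X`_(enum_rank L) = u L by rewrite nth_codom enum_rankK.
  have X_sum (c' : 'I_#|{: Gamma}| -> K) :
      \sum_i c' i *: X`_i = \sum_(L : Gamma) c' (enum_rank L) *: u L.
    rewrite (reindex enum_rank) /=; last exact/onW_bij/enum_rank_bij.
    by apply: eq_bigr => L _; rewrite X_nth.
  have X_free : free X.
    apply/freeP => c' /eqP; rewrite X_sum => /eqP c'0 i.
    have /ffunP/(_ (enum_val i)) : [ffun L => c' (enum_rank L)] = [ffun=> 0].
      apply: u_inj; rewrite [RHS]big1 => [|L _]; last by rewrite ffunE scale0r.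
      by rewrite -[RHS]c'0; apply: eq_bigr => L _; rewrite ffunE.
    by rewrite !ffunE enum_valK.
  have X_span : <<X>>%VS = {:F}%VS.
    apply/eqP; rewrite eqEsubv subvf; apply/subvP => z _.
    have [x [-> _]] := u_basis z; apply: memv_suml => L _; apply: memvZ.
    by apply: memv_span; apply: codom_f.
  by have /eqnP := X_free; rewrite X_span size_tuple => ->; rewrite /o cardfE.
apply/eqP/gal_eqP => z _; rewrite gal_id.
have [x [-> _]] := u_basis z; rewrite linear_sum; apply: eq_bigr => L _.
rewrite linearZ /=; congr (_ *: _).
(* The trivial class is written as g taken d times, to fit the exponents of [powers]. *)
have [i [DL]] : exists i, val L = g *+ i.+1.
  have [[|i] _ DL] := inG _ (valP L); last by exists i.
  by exists o.-1; rewrite prednK // go.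
have [c' [c'0 Dc' _]] := powers i L DL.
apply: (scalerI c'0); rewrite -linearZ /= -Dc' rmorphXn /= su //.
Qed.

End CyclicCovers.

(** * Coefficients of spectral polynomials and of their factors *)

Section SpectralPolynomials.

(** The list is non-empty because the empty product has no second coefficient: the truncated index
    would point at its leading one. *)
Lemma sublead_prod (F : fieldType) (I : Type) (i : I) (s : seq I) (G : I -> {poly F}) :
    (forall j, G j \is monic) -> (forall j, 1 < size (G j))%N ->
  (\prod_(j <- i :: s) G j)`_(size (\prod_(j <- i :: s) G j)).-2 =
    \sum_(j <- i :: s) (G j)`_(size (G j)).-2.
Proof.
move=> G_monic G_gt1; elim: s i => [|i' s IHs] i; first by rewrite !big_seq1.
rewrite [\prod_(j <- i :: _) G j]big_cons [\sum_(j <- i :: _) _]big_cons.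
rewrite subleadM ?IHs //; first exact: monic_prod.
rewrite big_cons size_monicM ?monic_neq0 ?monic_prod //.
have: (0 < size (\prod_(j <- s) G j)%R)%N by rewrite size_poly_gt0 monic_neq0 ?monic_prod.
move: (G_gt1 i'); case: (size (G i')) => [|[|x]] //.
by case: (size _) => [|y] //=; rewrite addnS.
Qed.

Lemma coef_spectral (K : fieldType) (n : nat) (a : 'I_n -> K) (j : 'I_n) :
  (spectral_poly a)`_(n - j.+1) = a j.
Proof.
rewrite /spectral_poly coefD coefXn coef_sum (bigD1 j) //= coefZ coefXn eqxx mulr1.
rewrite big1 ?addr0 => [|i ne_ij]; last first.
  rewrite coefZ coefXn eqn_sub2lE ?ltn_ord // eqSS eq_sym.
  by rewrite [_ == _ :> nat](negPf ne_ij) mulr0.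
by rewrite ltn_eqF ?add0r // rev_ord_proof.
Qed.

Lemma size_spectral_tail (K : fieldType) (n : nat) (a : 'I_n -> K) :
  (size (\sum_(j < n) a j *: 'X^(n - j.+1))%R <= n)%N.
Proof.
apply: leq_trans (size_sum _ _ _) _; apply/bigmax_leqP => j _.
by apply: leq_trans (size_scale_leq _ _) _; rewrite size_polyXn rev_ord_proof.
Qed.

Lemma size_spectral (K : fieldType) (n : nat) (a : 'I_n -> K) :
  size (spectral_poly a) = n.+1.
Proof. by rewrite size_polyDl size_polyXn // ltnS size_spectral_tail. Qed.

Lemma spectral_monic (K : fieldType) (n : nat) (a : 'I_n -> K) :
  spectral_poly a \is monic.
Proof.
by rewrite monicE lead_coefDl ?lead_coefXn // size_polyXn ltnS size_spectral_tail.
Qed.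

Lemma spectral_coefs (K : fieldType) (m : nat) (q : {poly K}) : q \is monic ->
  size q = m.+1 -> spectral_poly (fun j : 'I_m => q`_(m - j.+1)) = q.
Proof.
move=> q_monic size_q; apply/polyP => i; have [lt_im|le_mi] := ltnP i m.
  have lt_j : (m - i.+1 < m)%N by rewrite ltn_subrL (leq_ltn_trans _ lt_im).
  have Di : i = (m - (Ordinal lt_j).+1)%N by rewrite /= subnSK // subKn // ltnW.
  by rewrite [in LHS]Di coef_spectral -Di.
have [->|ne_im] := eqVneq i m.
  have := monicP (spectral_monic (fun j : 'I_m => q`_(m - j.+1))).
  rewrite lead_coefE size_spectral /= => ->.
  by have := monicP q_monic; rewrite lead_coefE size_q.
by rewrite !nth_default ?size_spectral ?size_q // ltn_neqAle eq_sym ne_im.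
Qed.

Variables (k : numClosedFieldType) (K : fieldType) (iota : {rmorphism k -> K}).
Variables (F : splittingFieldType K).
Local Notation Gal := ('Gal({:F} / 1%AS))%g.
Variables (M : divisor iota) (n : nat) (a : 'I_n -> K).
Hypothesis a_base : hitchin_base (mult_at M) a.

Lemma spectral_regular (Q : point (ext_const iota (in_alg F))) i :
  ord_ge Q (pullback (in_alg F) M Q *~ (i%:Z - n%:Z))
    (map_poly (in_alg F) (spectral_poly a))`_i.
Proof.
have [P [e [_ e0 QP ->]]] := pullbackE (finite_ext_algebraic (in_alg_finite_ext F)) Q.
have [lt_in|le_ni] := ltnP i n; last first.
  have [->|ne_in] := eqVneq i n.
    have := monicP (spectral_monic a); rewrite lead_coefE size_spectral /=.
    by rewrite coef_map /= => ->; rewrite subrr mulr0z scale1r /ord_ge ord1.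
  rewrite nth_default; first exact: ord_ge0.
  by rewrite size_map_poly size_spectral ltn_neqAle eq_sym ne_in.
have lt_j : (n - i.+1 < n)%N by rewrite ltn_subrL (leq_ltn_trans _ lt_in).
have Di : i = (n - (Ordinal lt_j).+1)%N by rewrite /= subnSK // subKn // ltnW.
have ai : (spectral_poly a)`_i = a (Ordinal lt_j).
  by rewrite [in LHS]Di coef_spectral.
rewrite coef_map /= ai -[_%:A]/(in_alg F _) => /=; rewrite /ord_ge => aj0.
have {}aj0 : a (Ordinal lt_j) != 0.
  by apply: contraNneq aj0 => ->; rewrite scale0r.
rewrite -[_%:A]/(in_alg F _) QP //.
have := @a_base (Ordinal lt_j) P aj0; rewrite /= subnSK // => Paj.
apply: le_trans (_ : e * - (mult_at M P *+ (n - i)) <= _); last by rewrite ler_pM2l.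
have -> : (i%:Z - n%:Z) = - (n - i)%N%:Z by rewrite -subzn ?opprB // ltnW.
by rewrite mulrNz -pmulrn mulrN mulrnAr.
Qed.

(** A polynomial divides its norm, with the product of the other conjugates as monic cofactor, so
    the Gauss lemma applies at each point. *)
Lemma norm_regular (q : {poly F}) (Q : point (ext_const iota (in_alg F))) i :
    q \is monic -> gal_norm q = map_poly (in_alg F) (spectral_poly a) ->
  ord_ge Q (pullback (in_alg F) M Q *~ (i%:Z - (size q).-1%:Z)) q`_i.
Proof.
move=> q_monic Nq; pose q' := \prod_(s in Gal | s != 1%g) map_poly s q.
have q'_monic : q' \is monic by apply: monic_prod => s _; rewrite monic_map.
have qq' : q * q' = map_poly (in_alg F) (spectral_poly a).
  by rewrite -Nq /gal_norm (bigD1 1%g) ?group1 //= map_poly_gal1.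
apply: gauss_monic q'_monic _ i => // i; rewrite qq' size_map_poly size_spectral.
exact: spectral_regular.
Qed.

(** This identifies a_1 with the trace of b_1. *)
Lemma sublead_gal_norm (q : {poly F}) : q \is monic -> (1 < size q)%N ->
  (gal_norm q)`_(size (gal_norm q)).-2 = \sum_(s in Gal) s q`_(size q).-2.
Proof.
move=> q_monic q_gt1.
rewrite /gal_norm -!big_enum /=.
have: 1%g \in enum Gal by rewrite mem_enum group1.
case: (enum _) => // s0 s _; rewrite sublead_prod => [|t|t].
- by apply: eq_bigr => t _; rewrite size_map_poly coef_map.
- by rewrite monic_map.
- by rewrite size_map_poly.
Qed.

End SpectralPolynomials.

(** * Decomposition into characters *)

Section CharacterDecomposition.
Variables (k : numClosedFieldType) (K : fieldType) (iota : {rmorphism k -> K}).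
Variables (F : splittingFieldType K).
Local Notation Gal := ('Gal({:F} / 1%AS))%g.
Variables (d : nat) (zeta : k) (h : K) (u : F).
Hypotheses (prim_zeta : d.-primitive_root zeta) (u0 : u != 0).
Hypotheses (card_Gal : #|Gal| = d) (uE : u ^+ d = h%:A).
Hypothesis u_gen : forall s : gal_of {:F}, s u = u -> s = 1%g.

Let const : {rmorphism k -> F} := ext_const iota (in_alg F).

Let prim_zetaK : d.-primitive_root (iota zeta).
Proof. by rewrite fmorph_primitive_root. Qed.

Let d_gt0 : (0 < d)%N. Proof. exact: prim_order_gt0 prim_zeta. Qed.

Let kexp := kummer_exp u prim_zetaK.

Let kexpP (s : gal_of {:F}) : s u = const (zeta ^+ kexp s) * u.
Proof. by rewrite /= rmorphXn /= -(kummer_expP prim_zetaK u0 uE). Qed.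

Let const_gal (s : gal_of {:F}) c : s (const c) = const c.
Proof. exact: gal_alg. Qed.

Let gal_constM (s : gal_of {:F}) c x : s (const c * x) = const c * s x.
Proof. by rewrite rmorphM; congr (_ * _); apply: const_gal. Qed.

Let zeta0 : zeta != 0.
Proof.
apply: contra_eq_neq (prim_expr_order prim_zeta) => ->.
by rewrite expr0n gtn_eqF //= eq_sym oner_neq0.
Qed.

Let kexpM (s t : gal_of {:F}) i :
  zeta ^+ (i * kexp (s * t)%g) = zeta ^+ (i * kexp s) * zeta ^+ (i * kexp t).
Proof.
rewrite -![(i * _)%N]mulnC !exprM -exprMn; congr (_ ^+ _).
apply: (fmorph_inj const); apply: (mulIf u0); rewrite -kexpP galM ?memvf // kexpP.
by rewrite rmorphM /= const_gal kexpP mulrA -rmorphM.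
Qed.

Let kexp1 : kexp 1%g = 0%N :> nat.
Proof.
have := kexpP 1%g; rewrite gal_id -{1}[u]mul1r => /(mulIf u0)/esym.
rewrite -(rmorph1 const) => /fmorph_inj/eqP.
by rewrite -(prim_order_dvd prim_zeta) /dvdn modn_small // => /eqP.
Qed.

Let kexp_eq0 (s : gal_of {:F}) : kexp s = 0%N :> nat -> s = 1%g.
Proof. by move=> s0; apply: u_gen; rewrite kexpP s0 expr0 rmorph1 mul1r. Qed.

(** The averaging projector onto the eigenspace of the i-th power of the Kummer character. *)
Let component (f : F) (i : nat) : F :=
  (d%:R)^-1 * \sum_(s in Gal) const (zeta ^+ (i * kexp s))^-1 * s f.

Let component_gal f i (t : gal_of {:F}) : t \in Gal ->
  t (component f i) = const (zeta ^+ (i * kexp t)) * component f i.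
Proof.
move=> tG; rewrite /component rmorphM fmorphV rmorph_nat mulrCA; congr (_ * _).
rewrite rmorph_sum mulr_sumr [RHS](reindex_inj (mulIg t)).
apply: eq_big => [s|s _]; first by rewrite groupMr.
rewrite [LHS]gal_constM galM ?memvf // mulrA -rmorphM kexpM invfM mulrCA divff ?mulr1 //.
exact: expf_neq0.
Qed.

(** Orthogonality of characters: for s other than 1, the sum over i is a full geometric sum of a
    non-trivial d-th root of unity and vanishes. *)
Let sum_component f : \sum_(i < d) component f i = f.
Proof.
have dF0 : d%:R != 0 :> F.
  by rewrite -(rmorph_nat const) fmorph_eq0 pnatr_eq0 -lt0n.
have -> : \sum_(i < d) component f i = (d%:R)^-1 *
    \sum_(s in Gal) const (\sum_(i < d) (zeta ^+ (i * kexp s))^-1) * s f.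
  rewrite -mulr_sumr exchange_big; congr (_ * _); apply: eq_bigr => s _.
  by rewrite -mulr_suml rmorph_sum.
rewrite (bigD1 1%g) ?group1 //= [X in _ + X]big1.
  rewrite addr0 gal_id kexp1; under eq_bigr do rewrite muln0 expr0 invr1.
  by rewrite sumr_const card_ord [(iota _)%:A](rmorph_nat const) mulrA mulVf ?mul1r.
move=> s /andP[_ s1]; set x := \sum_(i < d) _.
suff -> : x = 0 by rewrite [(iota _)%:A](rmorph0 const) mul0r.
have z1 : (zeta ^+ kexp s)^-1 != 1.
  rewrite invr_eq1; apply: contra s1; rewrite -(prim_order_dvd prim_zeta).
  by rewrite /dvdn modn_small // => /eqP/kexp_eq0->.
have /eqP : ((zeta ^+ kexp s)^-1 - 1) * x = 0.
  rewrite /x; under eq_bigr do rewrite mulnC exprM -exprVn.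
  rewrite -subrX1 exprVn -exprM mulnC exprM (prim_expr_order prim_zeta).
  by rewrite expr1n invr1 subrr.
by rewrite mulf_eq0 subr_eq0 (negPf z1) => /eqP.
Qed.

Lemma ord_geZ (Q : point const) c (f : F) (a : k) : ord_ge Q c f ->
  ord_ge Q c (const a * f).
Proof. by move=> Qf; rewrite -[c]add0r; apply/ord_geM/Qf/ord_ge_const. Qed.

(** The component of index 0 is the trace divided by d. The others, shifted to indices i + 1 below
    d, are regular as k-linear combinations of conjugates of f. *)
Lemma H0_var_of_trace0 (D : point const -> int) (f : F) :
    (forall s : gal_of {:F}, s \in Gal -> H0 D (s f)) ->
    \sum_(s in Gal) s f = 0 ->
  H0_var D f.
Proof.
move=> f_reg f_tr.
exists d.-1, (fun i s => zeta ^+ (i.+1 * kexp s)), (fun i => component f i.+1).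
split=> [i|]; last first.
  rewrite -{1}[f]sum_component; case: (d) d_gt0 => // d' _; rewrite big_ord_recl /=.
  have -> : component f 0 = 0.
    rewrite /component; under eq_bigr do rewrite mul0n expr0 invr1 rmorph1 ?scale1r mul1r.
    by rewrite f_tr mulr0.
  by rewrite add0r; apply: eq_bigr.
have lt_i : (i.+1 < d)%N by rewrite -[d in (_ < d)%N]prednK // ltnS.
split; first split.
- by rewrite kexp1 muln0 expr0.
- by move=> s t _ _; apply: kexpM.
(* The ordinal is 1: an automorphism with s(u) = zeta u has the character value zeta^(i+1), which
   differs from 1. *)
- have [s sG Ds] := kummer_exp_surj prim_zetaK u0 card_Gal uE (fun s _ => @u_gen s)
      (Ordinal (leq_ltn_trans (ltn0Sn i) lt_i)).
  exists s => //; rewrite /kexp Ds muln1 -(prim_order_dvd prim_zeta).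
  by rewrite /dvdn modn_small.
split=> [Q|s sG]; last exact: component_gal.
have -> : component f i.+1 = const d%:R^-1 *
    \sum_(s in Gal) const (zeta ^+ (i.+1 * kexp s))^-1 * s f.
  by rewrite fmorphV rmorph_nat.
apply/ord_geZ/ord_ge_sum => s sG; apply: ord_geZ.
exact: (f_reg s sG Q).
Qed.

End CharacterDecomposition.

(** * The criterion for spectral covers *)

Section Criterion.

Lemma in_qpoly_eq0 (K : fieldType) (p : {poly K}) (pI : monic_irreducible_poly p) V :
  (in_qpoly p V == 0) = (p %| V).
Proof.
by rewrite -val_eqE /= (mk_monicE pI) dvdpE.
Qed.

Lemma qfpoly_rootP (K : fieldType) (p : {poly K}) (pI : monic_irreducible_poly p)
    (d : nat) (c : K) :
  (exists v : {poly %/ p with pI}, v ^+ d = in_alg {poly %/ p with pI} c) <->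
  (exists V : {poly K}, p %| V ^+ d - c%:P).
Proof.
have algE : in_alg {poly %/ p with pI} c = in_qpoly p c%:P.
  by rewrite -alg_polyC linearZ /= rmorph1.
have rootE V : (p %| V ^+ d - c%:P) = ((in_qpoly p V : {poly %/ p with pI}) ^+ d
    == in_alg {poly %/ p with pI} c).
  by rewrite -(in_qpoly_eq0 pI) rmorphB rmorphXn /= subr_eq0 -algE.
split=> [[v vd]|[V]]; last by rewrite rootE => /eqP; exists (in_qpoly p V).
exists (val v); rewrite rootE -vd; apply/eqP; congr (_ ^+ _).
by apply: val_inj; apply: in_qpoly_small; apply: size_mk_monic.
Qed.

Theorem spectral_cover_criterion (k : numClosedFieldType) (K : fieldType)
    (iota : {rmorphism k -> K}) (curveK : function_field iota)
    (M : divisor iota) (n : nat) (n_gt0 : (0 < n)%N)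
    (Gamma : {fset Pic iota}) (cyclicGamma : cyclic_subgroup Gamma)
    (torsionGamma : forall L, L \in Gamma -> Pic0 L /\ L *+ n = 0)
    (F : splittingFieldType K) (coverF : cover_of Gamma F)
    (a : 'I_n -> K) (a_base : hitchin_base0 (mult_at M) a) :
  (forall L, L \in Gamma -> in_Ka a L) <-> in_A0_Gamma F M #|` Gamma| a.
Proof.
have [g Gg] := cyclicGamma; have g_in : g \in Gamma by apply/Gg; exists 1.
have [_ gn] := torsionGamma g g_in; have {a_base} [a_base a0] := a_base.
have [E [u [h [E_g u0 h0 uE [hE [card_Gal u_gen]]]]]] := cover_kummer Gg n_gt0 gn coverF.
have [d_gt0 _ d_n _] := cyclic_subgroup_order Gg n_gt0 gn.
set d := #|` Gamma| in uE hE card_Gal d_gt0 d_n *.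
have charK : [pchar K] =i pred0.
  by move=> q; rewrite (fmorph_pchar iota) pchar_num.
have galF := galois_char0 F charK.
have [|zeta prim_zeta] := @prim_root_exists k d; first by rewrite pnatr_eq0 -lt0n.
have prim_zetaK : d.-primitive_root (iota zeta) by rewrite fmorph_primitive_root.
have u_gen' (s : gal_of {:F}) : s \in 'Gal({:F} / 1%AS)%g -> s u = u -> s = 1%g by auto.
have s_monic := spectral_monic a; have s0 := monic_neq0 s_monic.
split=> [Gamma_Ka|[b [_ b_a]] L L_in]; last first.
  have [L0 _] := torsionGamma L L_in; split=> // p pI p_s.
  have [p_irr p_monic] := pI; have p_gt1 : (1 < size p)%N by case: p_irr.
  set m := multiplicity _ _; have [pm npm] := multiplicityP p_gt1 s0.
  have [t Dt] : exists t, spectral_poly a = p ^+ m * t.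
    by exists (spectral_poly a %/ p ^+ m); rewrite mulrC divpK.
  have npt : ~~ (p %| t).
    apply: contra npm => pt; rewrite [X in _ %| X]Dt exprSr -/m.
    by rewrite dvdp_mul2l ?expf_neq0 ?monic_neq0.
  have [|r [r_monic r_irr r_p]] := @monic_irreducible_factor _ (map_poly (in_alg F) p).
    by rewrite size_map_poly.
  have [||e [e_d Nr [T pT]]] := irreducible_factor_norm galF prim_zetaK u0 card_Gal uE
    _ p_irr p_monic _ r_monic r_irr r_p.
  - by have /pcharf0P-> := charK; rewrite -lt0n.
  - exact: irreducible_separable.
  have e_m : (e %| m)%N.
    apply: (gal_norm_split galF p_irr p_monic r_monic r_irr r_p Nr _ _ npt).
      exact: spectral_monic b.
    by rewrite -Dt.
  have [v vd] : exists v : {poly %/ p with pI},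
      v ^+ d = in_alg {poly %/ p with pI} (h ^+ m).
    (* Modulo p, T^(d/e) is h, so the d-th power of T^(m/e) is h^m. *)
    apply/qfpoly_rootP; exists (T ^+ (m %/ e)).
    apply: dvdp_trans pT _.
    rewrite -exprM; have -> : (m %/ e * d = (d %/ e) * m)%N.
      by rewrite -{1}(divnK e_d) mulnCA divnK.
    by rewrite exprM polyC_exp subrXX dvdp_mulIl.
  have [z Lz] := (Gg L).1 L_in; rewrite Lz -E_g.
  apply: (root_ker_pullback (qfpoly_finite_ext pI) h0 hE d_gt0 vd).
  by rewrite E_g -Lz.
have [q [q_monic Nq]] : exists q : {poly F}, q \is monic /\
    gal_norm q = map_poly (in_alg F) (spectral_poly a).
  apply: (@prime_power_ind _ (fun s => exists q : {poly F}, q \is monic /\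
    gal_norm q = map_poly (in_alg F) s)) s_monic _.
  - by exists 1; rewrite monic1 gal_norm1 rmorph1.
  - move=> s t [q [q_monic Nq]] [q' [q'_monic Nq']]; exists (q * q').
    by rewrite monicMl // gal_normM Nq Nq' rmorphM.
  move=> p p_irr p_monic p_s; have pI : monic_irreducible_poly p by [].
  have [_ /(_ p pI p_s)] := Gamma_Ka g g_in; rewrite -E_g.
  set m := multiplicity _ _.
  move=> /(ker_pullback_root curveK (qfpoly_finite_ext pI) h0 hE d_gt0)[v vd]; have m_gt0 : (0 < m)%N.
    have [_] := multiplicityP p_irr.1 s0; rewrite lt0n -/m.
    by apply: contraNneq => ->; rewrite expr1.
  have [w wh] := root_of_root_exp prim_zetaK h0 m_gt0 vd.
  have [T pT] : exists T : {poly K}, p %| T ^+ (d %/ gcdn d m) - h%:P.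
    by apply/(qfpoly_rootP pI); exists w.
  have [r r_monic Nr] := kummer_factor_norm prim_zetaK u0 card_Gal uE u_gen'
    p_monic (dvdn_gcdl d m) pT.
  (* With e = gcd(d, m) the norm of r is p^e, and the power m/e raises it to p^m. *)
  exists (r ^+ (m %/ gcdn d m)); rewrite monic_exp //; split=> //.
  by rewrite gal_normX Nr -rmorphXn -exprM mulnC divnK ?dvdn_gcdr.
have size_q : ((size q).-1 * d)%N = n.
  have := congr1 (fun r : {poly F} => size r) Nq.
  rewrite size_map_poly size_spectral.
  rewrite size_prod => [|s _]; last by rewrite map_poly_eq0 monic_neq0.
  under eq_bigr do rewrite size_map_poly.
  rewrite sum_nat_const card_Gal -subn1 mulnBl mul1n mulnC.
  have le_d : (d <= size q * d)%N by rewrite leq_pmull // size_poly_gt0 monic_neq0.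
  by rewrite subSn // => -[].
have size_q' : size q = (n %/ d).+1.
  by rewrite -size_q mulnK // prednK // size_poly_gt0 monic_neq0.
have q_gt1 : (1 < size q)%N.
  by rewrite size_q' ltnS divn_gt0 // dvdn_leq.
exists (fun j => q`_(n %/ d - j.+1)); split; last first.
  by rewrite /is_Phi spectral_coefs.
(* Stated for any r with the norm and size of q, so as to cover the conjugates of q: the projectors
   onto characters involve all conjugates of b_1. *)
have regular_q (r : {poly F}) (j : nat) (Q : point (ext_const iota (in_alg F))) :
    r \is monic -> gal_norm r = gal_norm q -> size r = size q -> (j < n %/ d)%N ->
    ord_ge Q (- (pullback (in_alg F) M Q *+ j.+1)) r`_(n %/ d - j.+1).
  move=> r_monic Nr size_r lt_j.
  apply: ord_geW (norm_regular a_base Q r_monic (etrans Nr Nq)).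
  by rewrite size_r size_q' /= -subzn // addrAC subrr add0r mulrNz -pmulrn.
split=> [j Q|j j0].
  exact: (regular_q q j Q).
have q_sub : q`_(n %/ d - j.+1) = q`_(size q).-2 by rewrite j0 size_q' subn1.
apply: (H0_var_of_trace0 prim_zeta u0 card_Gal uE u_gen) => [s sG Q|].
  have := regular_q (map_poly s q) j Q; rewrite monic_map // gal_norm_gal // size_map_poly.
  by move=> /(_ isT erefl erefl (ltn_ord j)); rewrite coef_map j0 mulr1n.
(* The trace of b_1 is a_1, which is zero. *)
rewrite q_sub -sublead_gal_norm // Nq size_map_poly size_spectral coef_map /=.
have := coef_spectral a (Ordinal n_gt0); rewrite subn1 => ->.
by rewrite a0 // scale0r.
Qed.

End Criterion.

Theorem theorem1p2 (R : realType) (K : fieldType)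
    (iota : {rmorphism R[i] -> K}) (curveK : function_field iota)
    (M : divisor iota) (degM : 0 < deg M)
    (n : nat) (n_ge2 : (2 <= n)%N)
    (d : nat) (Gamma : {fset Pic iota})
    (cyclicGamma : cyclic_subgroup Gamma) (orderGamma : #|` Gamma| = d)
    (torsionGamma : forall L, L \in Gamma -> Pic0 L /\ L *+ n = 0)
    (F : splittingFieldType K) (coverF : cover_of Gamma F)
    (a : 'I_n -> K) (a_in_A0 : hitchin_base0 (mult_at M) a) :
  (forall L, L \in Gamma -> in_Ka a L) <-> in_A0_Gamma F M d a.
Proof.
rewrite -orderGamma.
by apply: (@spectral_cover_criterion R[i] K iota) => //; apply: ltnW.
Qed.
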